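(* Let $T$ be a bounded linear operator on $L^2$. Then $T=S_{\alpha,\beta}$ for some $\alpha,\beta\in L^\infty$ if and only if there exist constants $a_n,b_n\in\mathbb{C}$ ($n\in\mathbb{Z}$) such that the matrix of $T$ with respect to the orthonormal basis $\{z^n\}_{n=-\infty}^{\infty}$ satisfies, for all $m,n\in\mathbb{Z}$, $$\langle Tz^n,z^m\rangle=\begin{cases}a_{m-n}, & n\ge 0,\\ b_{m-n}, & n\le -1.\end{cases}$$ In this case $a_n=\hat\alpha(n)$ and $b_n=\hat\beta(n)$ for all $n\in\mathbb{Z}$.
   Context: $S^1=\{z\in\mathbb{C}:|z|=1\}$ carries normalized Lebesgue measure; $L^2=L^2(S^1)$, $L^\infty=L^\infty(S^1)$ (complex-valued functions), with inner product $\langle f,g\rangle=\frac1{2\pi}\int_0^{2\pi}f(e^{i\theta})\overline{g(e^{i\theta})}\,d\theta$. $\hat f(n)=\langle f,z^n\rangle$ is the $n$-th Fourier coefficient. $H^2$ is the Hardy space of all $f\in L^2$ with $\hat f(n)=0$ for $n<0$, and $H^{2\bot}$ is its orthogonal complement in $L^2$. $P$ and $Q=I-P$ are the orthogonal projections of $L^2$ onto $H^2$ and $H^{2\bot}$. For $\alpha,\beta\in L^\infty$, the operator $S_{\alpha,\beta}$ on $L^2$ is $S_{\alpha,\beta}f=\alpha Pf+\beta Qf$. The $(m,n)$ matrix entry of $T$ is $\langle Tz^n,z^m\rangle$. *)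

(* Defs.v *)
From HB Require Import structures.
From mathcomp Require Import all_boot all_order all_algebra.
From mathcomp Require Import all_classical all_reals all_analysis.
From mathcomp Require Import measurable_realfun ess_sup_inf complex.

Set Implicit Arguments.
Unset Strict Implicit.
Unset Printing Implicit Defensive.

Import Order.TTheory GRing.Theory Num.Theory.
Import numFieldNormedType.Exports.

Local Open Scope classical_set_scope.
Local Open Scope ring_scope.
Local Open Scope complex_scope.

Local Notation Re := complex.Re.
Local Notation Im := complex.Im.
Local Notation normc := Normc.normc.

Section ComplexFun.
Context d (T : measurableType d) (R : realType).
Implicit Types f g : T -> R[i].

(* Borel measurability as a map to the complex plane, through coordinates. *)
Definition cmeasurable f : Prop :=
  measurable_fun [set: T] (fun x => Re (f x)) /\
  measurable_fun [set: T] (fun x => Im (f x)).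

Lemma cmeasurable0 : cmeasurable 0.
Proof. by split; exact: measurable_cst. Qed.

Lemma cmeasurableD f g : cmeasurable f -> cmeasurable g -> cmeasurable (f + g).
Proof.
move=> [rf jf] [rg jg]; split.
  rewrite (_ : (fun x => _) = (fun x => Re (f x)) \+ (fun x => Re (g x))).
    exact: measurable_funD.
  by apply/funext => x /=; rewrite fctE; case: (f x) (g x) => [? ?] [? ?].
rewrite (_ : (fun x => _) = (fun x => Im (f x)) \+ (fun x => Im (g x))).
  exact: measurable_funD.
by apply/funext => x /=; rewrite fctE; case: (f x) (g x) => [? ?] [? ?].
Qed.

Lemma cmeasurableM f g : cmeasurable f -> cmeasurable g ->
  cmeasurable (fun x => f x * g x).
Proof.
move=> [rf jf] [rg jg]; split.
  rewrite (_ : (fun x => _) = ((fun x => Re (f x)) \* (fun x => Re (g x))) \-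
                              ((fun x => Im (f x)) \* (fun x => Im (g x)))).
    by apply: measurable_funB; exact: measurable_funM.
  by apply/funext => x /=; case: (f x) (g x) => [? ?] [? ?].
rewrite (_ : (fun x => _) = ((fun x => Re (f x)) \* (fun x => Im (g x))) \+
                            ((fun x => Im (f x)) \* (fun x => Re (g x)))).
  by apply: measurable_funD; exact: measurable_funM.
by apply/funext => x /=; case: (f x) (g x) => [? ?] [? ?] //=.
Qed.

Lemma measurable_normc f : cmeasurable f ->
  measurable_fun [set: T] (fun x => normc (f x)).
Proof.
move=> [rf jf].
rewrite (_ : (fun x => _) =
  Num.sqrt \o (fun x => (Re (f x)) ^+ 2 + (Im (f x)) ^+ 2)); last first.
  by apply/funext => x /=; case: (f x).
apply: measurableT_comp.
  by apply: continuous_measurable_fun; exact: sqrt_continuous.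
by apply: measurable_funD; exact: measurable_funX.
Qed.

Lemma ler_normcD (x y : R[i]) : normc (x + y) <= normc x + normc y.
Proof.
have : (normc (x + y))%:C <= (normc x + normc y)%:C.
  by rewrite rmorphD /=; exact: (@ler_normD R[i] R[i] x y).
by rewrite lecR.
Qed.

End ComplexFun.

Section ComplexLfun.
Context d (T : measurableType d) (R : realType).
Variables (mu : {measure set T -> \bar R}) (p : \bar R).
Implicit Types f g : T -> R[i].
Local Open Scope ereal_scope.

Definition cLnorm f : \bar R := 'N[mu]_p[EFin \o (fun x => normc (f x))].

Definition cLfun : {pred T -> R[i]} :=
  mem [set f | cmeasurable f /\ cLnorm f < +oo].

Lemma cLfunP f : reflect (cmeasurable f /\ cLnorm f < +oo) (f \in cLfun).
Proof. by apply: (iffP idP) => [/set_mem|/mem_set]. Qed.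

Lemma normc_ge0 (z : R[i]) : (0 <= normc z)%R.
Proof. by case: z => a b; exact: sqrtr_ge0. Qed.

Lemma ae_le_Lnorm (u v : T -> R) : 1 <= p ->
  measurable_fun [set: T] u -> measurable_fun [set: T] v ->
  (\forall x \ae mu, (`|u x| <= `|v x|)%R) ->
  'N[mu]_p[EFin \o u] <= 'N[mu]_p[EFin \o v].
Proof.
rewrite unlock; case: p => [r| |//] p1 mu_ mv uv /=; last first.
  case: ifPn => // _; apply: le_ess_sup.
  by apply: filterS uv => x; rewrite lee_fin.
have r0 : (0 < r)%R by rewrite lee_fin in p1; exact: lt_le_trans p1.
have mpow (w : T -> R) : measurable_fun [set: T] w ->
    measurable_fun [set: T] (fun x => (`|w x| `^ r)%:E).
  move=> mw; apply/measurable_EFinP.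
  apply: (measurableT_comp (measurable_powR _)) => //.
  exact: measurableT_comp.
apply: gt0_ler_poweR.
- by rewrite invr_ge0 ltW.
- by rewrite in_itv/= leey integral_ge0// => x _; exact: poweR_ge0.
- by rewrite in_itv/= leey integral_ge0// => x _; exact: poweR_ge0.
apply: ae_ge0_le_integral => //; [exact: mpow|exact: mpow|].
apply: filterS uv => x uvx _ /=; rewrite lee_fin.
by apply: ge0_ler_powR => //; [exact: ltW|rewrite nnegrE..].
Qed.

Hypothesis p1 : 1 <= p.

Lemma cLfun_real f : cmeasurable f -> cLnorm f < +oo ->
  (fun x => normc (f x)) \in Lfun mu p.
Proof.
by move=> mf nf; apply/andP; split; rewrite inE//=; exact: measurable_normc.
Qed.

Lemma ae_le_cLnorm f (v : T -> R) : cmeasurable f -> v \in Lfun mu p ->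
  (\forall x \ae mu, (normc (f x) <= `|v x|)%R) -> f \in cLfun.
Proof.
move=> mf /andP[/set_mem mv /set_mem fin_v] fv.
apply/cLfunP; split => //.
apply: le_lt_trans fin_v; apply: ae_le_Lnorm => //.
  exact: measurable_normc.
by apply: filterS fv => x fvx; rewrite ger0_norm ?normc_ge0.
Qed.

Lemma cLfun0 : 0%R \in cLfun.
Proof.
apply: (@ae_le_cLnorm _ (cst 0%R)); first exact: cmeasurable0.
  exact: rpred0.
by apply: aeW => x; rewrite Normc.normc0.
Qed.

Lemma cLfunD f g : f \in cLfun -> g \in cLfun -> (f + g)%R \in cLfun.
Proof.
move=> /cLfunP[mf nf] /cLfunP[mg ng].
apply: (@ae_le_cLnorm _ ((fun x => normc (f x)) + (fun x => normc (g x)))%R).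
- exact: cmeasurableD.
- by apply: rpredD => //; exact: cLfun_real.
- apply: aeW => x; rewrite !fctE ger0_norm ?addr_ge0 ?normc_ge0//.
  exact: ler_normcD.
Qed.

Lemma cLfunZ (a : R[i]) f : f \in cLfun -> (a *: f)%R \in cLfun.
Proof.
move=> /cLfunP[mf nf].
apply: (@ae_le_cLnorm _ (normc a *: (fun x => normc (f x)))%R).
- by apply: cmeasurableM => //; split; exact: measurable_cst.
- by apply: rpredZ; exact: cLfun_real.
- apply: aeW => x; rewrite !fctE.
  by rewrite ger0_norm ?mulr_ge0 ?normc_ge0// Normc.normcM.
Qed.

End ComplexLfun.

Section ComplexLspace.
Context d (T : measurableType d) (R : realType).
Variables (mu : {measure set T -> \bar R}) (p : \bar R) (p1 : (1 <= p)%E).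

Lemma cLfun_submod_closed : submod_closed (cLfun mu p).
Proof.
split; first exact: cLfun0.
by move=> a f g Lf Lg; apply: cLfunD => //; exact: cLfunZ.
Qed.

HB.instance Definition _ := GRing.isSubmodClosed.Build _ _ (cLfun mu p)
  cLfun_submod_closed.

(* p1 is a phantom argument: the module structure needs 1 <= p. *)
Definition cLfunType (_ : (1 <= p)%E) := {f : T -> R[i] | f \in cLfun mu p}.
HB.instance Definition _ := SubChoice.on (cLfunType p1).
HB.instance Definition _ := [SubChoice_isSubLmodule of cLfunType p1 by <:].

Implicit Types f g h : cLfunType p1.

Definition ae_eqb f g : bool := `[< val f = val g %[ae mu] >].

Lemma ae_eqb_refl : reflexive ae_eqb.
Proof. by move=> f; apply/asboolP; exact: ae_eq_refl. Qed.

Lemma ae_eqb_sym : symmetric ae_eqb.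
Proof. by move=> f g; apply/idP/idP => /asboolP ?; apply/asboolP/ae_eq_sym. Qed.

Lemma ae_eqb_trans : transitive ae_eqb.
Proof.
by move=> f g h /asboolP gf /asboolP fh; apply/asboolP/(ae_eq_trans gf fh).
Qed.

Canonical ae_eqb_equiv := EquivRel ae_eqb ae_eqb_refl ae_eqb_sym ae_eqb_trans.

Local Open Scope quotient_scope.

(* The complex L^p space: classes modulo equality almost everywhere. *)
Definition cLspace : Type := {eq_quot ae_eqb}.
HB.instance Definition _ := Choice.on cLspace.
HB.instance Definition _ := EqQuotient.on cLspace.

Definition cLclass (f : T -> R[i]) (Lf : f \in cLfun mu p) : cLspace :=
  \pi_cLspace (Sub f Lf : cLfunType p1).

Definition cLspace_fun (u : cLspace) : T -> R[i] :=
  val (repr u : cLfunType p1).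
Coercion cLspace_fun : cLspace >-> Funclass.

Lemma cLspace_funP (u : cLspace) : (u : T -> R[i]) \in cLfun mu p.
Proof. exact: valP. Qed.

Lemma cLclassP f g :
  (val f = val g %[ae mu]) <-> \pi_cLspace f = \pi_cLspace g.
Proof. by split=> [fg|/eqmodP/asboolP//]; apply/eqmodP/asboolP. Qed.

Lemma cLclassK f : cLspace_fun (\pi_cLspace f) = val f %[ae mu].
Proof. by apply/cLclassP; rewrite reprK. Qed.

Lemma cLspace_eqP (u v : cLspace) :
  u = v <-> (u : T -> R[i]) = (v : T -> R[i]) %[ae mu].
Proof.
by rewrite -[in X in X <-> _](reprK u) -[in X in X <-> _](reprK v) cLclassP.
Qed.

Definition cLspace_add (u v : cLspace) : cLspace := \pi_cLspace (repr u + repr v).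
Definition cLspace_opp (u : cLspace) : cLspace := \pi_cLspace (- repr u).
Definition cLspace_scale (a : R[i]) (u : cLspace) : cLspace := \pi_cLspace (a *: repr u).

Lemma cLspace_addE f g :
  cLspace_add (\pi_cLspace f) (\pi_cLspace g) = \pi_cLspace (f + g).
Proof.
apply/cLclassP; have := cLclassK f; have := cLclassK g.
apply: filterS2 => x gx fx _.
change (cLspace_fun (\pi_cLspace f) x + cLspace_fun (\pi_cLspace g) x =
  val f x + val g x).
by rewrite gx// fx.
Qed.

Lemma cLspace_oppE f : cLspace_opp (\pi_cLspace f) = \pi_cLspace (- f).
Proof.
apply/cLclassP; have := cLclassK f.
apply: filterS => x fx _.
change (- cLspace_fun (\pi_cLspace f) x = - val f x).
by rewrite fx.
Qed.

Lemma cLspace_scaleE a f : cLspace_scale a (\pi_cLspace f) = \pi_cLspace (a *: f).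
Proof.
apply/cLclassP; have := cLclassK f.
apply: filterS => x fx _.
change (a * cLspace_fun (\pi_cLspace f) x = a * val f x).
by rewrite fx.
Qed.

Lemma cLspace_addA : associative cLspace_add.
Proof.
move=> u v w; rewrite -(reprK u) -(reprK v) -(reprK w).
rewrite (cLspace_addE (repr v)) (cLspace_addE (repr u) (repr v)).
by rewrite (cLspace_addE (repr u)) (cLspace_addE _ (repr w)) addrA.
Qed.

Lemma cLspace_addC : commutative cLspace_add.
Proof. by move=> u v; rewrite -(reprK u) -(reprK v) !cLspace_addE addrC. Qed.

Lemma cLspace_add0 : left_id (\pi_cLspace 0) cLspace_add.
Proof. by move=> u; rewrite -(reprK u) !cLspace_addE add0r. Qed.

Lemma cLspace_addN : left_inverse (\pi_cLspace 0) cLspace_opp cLspace_add.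
Proof.
by move=> u; rewrite -(reprK u) cLspace_oppE !cLspace_addE addNr.
Qed.

HB.instance Definition _ := GRing.isZmodule.Build cLspace
  cLspace_addA cLspace_addC cLspace_add0 cLspace_addN.

Lemma cLspace_scaleA (a b : R[i]) (u : cLspace) :
  cLspace_scale a (cLspace_scale b u) = cLspace_scale (a * b) u.
Proof.
rewrite -(reprK u) (cLspace_scaleE b (repr u)).
by rewrite (cLspace_scaleE a) (cLspace_scaleE (a * b)) scalerA.
Qed.

Lemma cLspace_scale1 : left_id 1 cLspace_scale.
Proof. by move=> u; rewrite -(reprK u) cLspace_scaleE scale1r. Qed.

Lemma cLspace_scaleDr : right_distributive cLspace_scale +%R.
Proof.
move=> a u v; rewrite -(reprK u) -(reprK v).
rewrite [X in cLspace_scale a X](cLspace_addE (repr u) (repr v)).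
rewrite (cLspace_scaleE a (repr u + repr v)) scalerDr.
rewrite (cLspace_scaleE a (repr u)) (cLspace_scaleE a (repr v)).
exact/esym/(cLspace_addE (a *: repr u) (a *: repr v)).
Qed.

Lemma cLspace_scaleDl (u : cLspace) :
  {morph cLspace_scale^~ u : a b / a + b}.
Proof.
move=> a b; rewrite -(reprK u) (cLspace_scaleE (a + b) (repr u)) scalerDl.
rewrite (cLspace_scaleE a (repr u)) (cLspace_scaleE b (repr u)).
exact/esym/(cLspace_addE (a *: repr u) (b *: repr u)).
Qed.

HB.instance Definition _ := GRing.Zmodule_isLmodule.Build R[i] cLspace
  cLspace_scaleA cLspace_scale1 cLspace_scaleDr cLspace_scaleDl.

End ComplexLspace.

Section Multiplication.
Context d (T : measurableType d) (R : realType).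
Variables (mu : {measure set T -> \bar R}).
Implicit Types f g : T -> R[i].

Lemma cLfun_ess_bounded f : f \in cLfun mu +oo%E ->
  exists M : R, \forall x \ae mu, normc (f x) <= M.
Proof.
move=> /cLfunP[_]; rewrite /cLnorm unlock; case: ifPn => [_ nf|].
  have [M fM] := ess_supr_bounded (f := fun x => `|normc (f x)|) nf.
  by exists M; apply: filterS fM => x; rewrite ger0_norm ?normc_ge0.
rewrite -leNgt measure_le0 => /eqP mu0 _.
by exists 0; exact: measure0_ae.
Qed.

Lemma cLfunM (p : \bar R) f g : (1 <= p)%E ->
  f \in cLfun mu +oo%E -> g \in cLfun mu p -> (fun x => f x * g x) \in cLfun mu p.
Proof.
move=> p1 Lf /cLfunP[mg ng]; have [M fM] := cLfun_ess_bounded Lf.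
move/cLfunP : Lf => [mf _].
apply: (@ae_le_cLnorm _ _ _ _ _ p1 _ (M *: (fun x => normc (g x)))).
- exact: cmeasurableM.
- by apply: rpredZ; exact: cLfun_real.
- apply: filterS fM => x fM; rewrite Normc.normcM !fctE.
  rewrite normrM [`|normc _|]ger0_norm ?normc_ge0// ler_wpM2r ?normc_ge0//.
  exact: le_trans (ler_norm _).
Qed.

(* ltW (ltry 1) : 1 <= +oo, so u ranges over the complex L^oo space. *)
Definition cLspace_mul (p : \bar R) (p1 : (1 <= p)%E)
    (u : cLspace mu (ltW (ltry 1))) (v : cLspace mu p1) : cLspace mu p1 :=
  cLclass p1 (cLfunM p1 (cLspace_funP u) (cLspace_funP v)).

Definition cintegral f : R[i] :=
  (\int[mu]_x Re (f x))%R +i* (\int[mu]_x Im (f x))%R.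

Definition cinner f g : R[i] := cintegral (fun x => f x * (g x)^*).

End Multiplication.

Definition circle (R : realType) : Type := {z : R[i] | `|z| == 1}.
HB.instance Definition _ (R : realType) := SubChoice.on (circle R).

Section Circle.
Variable R : realType.

HB.instance Definition _ := isPointed.Build (circle R)
  (exist _ (1 : R[i]) (introT eqP (normr1 R[i]))).

Definition circle_coord (z : circle R) : measurableTypeR R * measurableTypeR R :=
  (Re (val z), Im (val z)).

(* The trace on the circle of the Borel sigma-algebra of the plane. *)
HB.instance Definition _ := Measurable.copy (circle R)
  (g_sigma_algebra_preimageType circle_coord).

Lemma measurable_circle_coord : measurable_fun [set: circle R] circle_coord.
Proof. by move=> _ B mB; exists B. Qed.

Lemma normr_cis (t : R) : `|cos t +i* sin t| == 1 :> R[i].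
Proof. by rewrite normc_def /= cos2Dsin2 sqrtr1. Qed.

Definition cis (t : measurableTypeR R) : circle R :=
  exist _ (cos t +i* sin t) (normr_cis t).

Lemma measurable_cis : measurable_fun [set: measurableTypeR R] cis.
Proof.
move=> _ _ [B mB <-]; rewrite !setTI.
have /(_ measurableT _ mB) : measurable_fun [set: measurableTypeR R]
    (fun t : measurableTypeR R =>
      (cos t, sin t) : measurableTypeR R * measurableTypeR R).
  by apply: measurable_fun_pair; apply: continuous_measurable_fun;
    [exact: continuous_cos|exact: continuous_sin].
by rewrite setTI.
Qed.

HB.instance Definition _ := isMeasurableFun.Build _ _ _ _ cis measurable_cis.

Lemma twopi_gt0 : 0 < 2 * pi :> R.
Proof. by rewrite mulr_gt0// pi_gt0. Qed.

(* Normalized Lebesgue measure on the circle is the law of e^(it) for t uniform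
   on [0, 2 * pi]. *)
Definition circle_measure : probability (circle R) R :=
  distribution (uniform_prob twopi_gt0) cis.

Definition monomial (n : int) (z : circle R) : R[i] := val z ^ n.

Lemma normc_monomial n z : normc (monomial n z) = 1.
Proof.
apply: (@complexI R); have /eqP z1 := valP z.
change (`|monomial n z| = 1); rewrite /monomial.
by case: n => k; rewrite ?NegzE -?exprnN -?exprnP ?normfV normrX z1 expr1n ?invr1.
Qed.

Lemma monomialV n z : monomial (- n) z = (monomial n z)^*.
Proof.
rewrite /monomial -invr_expz; set w := val z ^ n.
have w1 : w * w^* = 1.
  have := normc_monomial n z; rewrite /monomial -/w.
  case: w => a b /= ab; apply/eqP; rewrite eq_complex /=.
  apply/andP; split; apply/eqP; last by rewrite mulrN mulrC addNr.
  rewrite mulrN opprK -!expr2.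
  by rewrite -[_ + _]sqr_sqrtr ?ab ?expr1n// addr_ge0 ?sqr_ge0.
have w0 : w != 0 by apply: contra_eq_neq w1 => ->; rewrite mul0r eq_sym oner_eq0.
by apply: (mulfI w0); rewrite w1 divff.
Qed.

Lemma cmeasurable_monomial n : cmeasurable (monomial n).
Proof.
have mX (k : nat) : cmeasurable (monomial k).
  elim: k => [|k IHk].
    by split; exact: measurable_cst.
  have -> : monomial k.+1 = fun z => val z * monomial k z.
    by apply/funext => z; rewrite /monomial -!exprnP exprS.
  apply: cmeasurableM => //; split.
    exact: (measurableT_comp measurable_fst measurable_circle_coord).
  exact: (measurableT_comp measurable_snd measurable_circle_coord).
case: n => k; first exact: mX.
rewrite NegzE; have [rk ik] := mX k.+1; split.
  rewrite (_ : (fun x => _) = (fun x => Re (monomial k.+1 x)))//.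
  by apply/funext => z; rewrite monomialV; case: monomial.
rewrite (_ : (fun x => _) = \- (fun x => Im (monomial k.+1 x))).
  exact: measurableT_comp.
apply/funext => z; rewrite monomialV.
by change (Im (monomial k.+1 z)^* = - Im (monomial k.+1 z)); case: monomial.
Qed.

Lemma monomial_L2 n : monomial n \in cLfun circle_measure 2%:E.
Proof.
apply: (@ae_le_cLnorm _ _ _ _ _ (lee1n 2) _ (cst 1)).
- exact: cmeasurable_monomial.
- exact: Lfun_cst.
- by apply: aeW => z; rewrite normc_monomial normr1.
Qed.

End Circle.

Definition L2 (R : realType) : Type := cLspace (@circle_measure R) (lee1n 2).
HB.instance Definition _ (R : realType) := GRing.Lmodule.on (L2 R).
Identity Coercion L2_cLspace : L2 >-> cLspace.

Definition Linfty (R : realType) : Type :=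
  cLspace (@circle_measure R) (ltW (ltry 1)).
HB.instance Definition _ (R : realType) := GRing.Lmodule.on (Linfty R).
Identity Coercion Linfty_cLspace : Linfty >-> cLspace.

Section Operators.
Variable R : realType.

Definition zpow (n : int) : L2 R := cLclass (lee1n 2) (monomial_L2 R n).

Definition inner (f g : L2 R) : R[i] := cinner (@circle_measure R) f g.

(* Defined on functions, so that it applies to elements of both L2 and Linfty;
   fourier f n = (1 / 2pi) int_0^2pi f(e^it) e^(-int) dt. *)
Definition fourier (f : circle R -> R[i]) (n : int) : R[i] :=
  cinner (@circle_measure R) f (@monomial R n).

Definition H2 : set (L2 R) := [set f | forall n : int, n < 0 -> fourier f n = 0].

Definition orthocomplement (V : set (L2 R)) : set (L2 R) :=
  [set g | forall f, V f -> inner g f = 0].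

(* The point h of V with f - h orthogonal to V: unique when it exists, and it
   exists when V is a closed subspace, such as H2. The default 0 of xget is only
   reached for other V. *)
Definition orthoproj (V : set (L2 R)) (f : L2 R) : L2 R :=
  xget 0 [set h | V h /\ orthocomplement V (f - h)].

Definition projP : L2 R -> L2 R := orthoproj H2.

Definition projQ (f : L2 R) : L2 R := f - projP f.

Definition opS (alpha beta : Linfty R) (f : L2 R) : L2 R :=
  (cLspace_mul alpha (projP f) : L2 R) + (cLspace_mul beta (projQ f) : L2 R).

Definition bounded_operator (T : L2 R -> L2 R) : Prop :=
  exists M : R, forall f : L2 R,
    (cLnorm (@circle_measure R) 2%:E (T f) <=
       M%:E * cLnorm (@circle_measure R) 2%:E f)%E.

End Operators.

(* Main.v *)
(** The matrix of [S_{alpha,beta}] is read off from [P z^n = z^n] for [n >= 0]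
    and [P z^n = 0] for [n < 0].  Conversely, put [alpha = T 1] and
    [beta = z T(z^-1)].  By uniqueness of Fourier coefficients, the matrix
    condition says that [T z^n] is [alpha z^n] for [n >= 0] and [beta z^n] for
    [n < 0].  Since [|z| = 1], multiplying a trigonometric polynomial [p] by a
    power of [z] gives [|alpha p| <= M |p|] and [|beta p| <= M |p|] in L2, and
    letting [p] tend to the indicator function of a set [E] bounds the integral
    of [|alpha|^2] over [E] by [M^2 mu(E)]; hence [alpha] and [beta] are bounded.
    Then [T = S_{alpha,beta}] on trigonometric polynomials extends to L2, because
    suitable partial Fourier sums converge both in L2 and almost everywhere.

    Uniqueness of Fourier coefficients: call a bounded real function a multiplier
    if multiplication by it preserves the set of integrable functions with zero
    Fourier coefficients.  Multipliers form an algebra that is closed under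
    bounded pointwise limits and contains the coordinates [Re z] and [Im z];
    iterating a cubic polynomial shows that it is closed under the sign function,
    so that it contains the indicator functions of all Borel sets. *)
Require Import Defs.
From mathcomp Require Import all_boot all_order all_algebra.
From mathcomp Require Import all_classical all_reals all_analysis.
From mathcomp Require Import measurable_realfun ess_sup_inf complex.
From mathcomp Require Import ring lra zify.

Set Implicit Arguments.
Unset Strict Implicit.
Unset Printing Implicit Defensive.

Import Order.TTheory GRing.Theory Num.Theory.
Import numFieldNormedType.Exports.

(* [ring_scope] is opened last so that [z^*] is [Num.conj], as in [cinner],
   and not [conjc]. *)
Local Open Scope complex_scope.
Local Open Scope classical_set_scope.
Local Open Scope ring_scope.

Local Notation Re := (@complex.Re _).
Local Notation Im := (@complex.Im _).
Local Notation normc := (@Normc.normc _).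

(** * Complex-valued integrals *)

Section ComplexFacts.
Context {R : realType}.
Implicit Types z w : R[i].

Lemma normc_sqr z : normc z ^+ 2 = Re z ^+ 2 + Im z ^+ 2.
Proof. by case: z => a b /=; rewrite sqr_sqrtr// addr_ge0 ?sqr_ge0. Qed.

Lemma normr_Re_le z : `|Re z| <= normc z.
Proof.
rewrite -(@ler_pXn2r _ 2)// ?nnegrE ?normc_ge0// normc_sqr.
by rewrite real_normK ?num_real// lerDl sqr_ge0.
Qed.

Lemma normr_Im_le z : `|Im z| <= normc z.
Proof.
rewrite -(@ler_pXn2r _ 2)// ?nnegrE ?normc_ge0// normc_sqr.
by rewrite real_normK ?num_real// lerDr sqr_ge0.
Qed.

Lemma normc_le_ReIm z : normc z <= `|Re z| + `|Im z|.
Proof.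
rewrite -(@ler_pXn2r _ 2)// ?nnegrE ?normc_ge0// ?addr_ge0// normc_sqr.
rewrite sqrrD !real_normK ?num_real// -addrA lerD2l lerDr.
by rewrite mulrn_wge0// mulr_ge0.
Qed.

Lemma cReM z w : Re (z * w) = Re z * Re w - Im z * Im w.
Proof. by case: z => a b; case: w. Qed.

Lemma cImM z w : Im (z * w) = Re z * Im w + Im z * Re w.
Proof. by case: z => a b; case: w. Qed.

Lemma cReM_real z (a : R) : Re (z * a%:C%C) = Re z * a.
Proof. by case: z => x y /=; rewrite mulr0 subr0. Qed.

Lemma cImM_real z (a : R) : Im (z * a%:C%C) = Im z * a.
Proof. by case: z => x y /=; rewrite mulr0 add0r. Qed.

Lemma cReD z w : Re (z + w) = Re z + Re w.
Proof. by case: z => a b; case: w. Qed.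

Lemma cImD z w : Im (z + w) = Im z + Im w.
Proof. by case: z => a b; case: w. Qed.

Lemma cRe_conj z : Re z^* = Re z. Proof. by case: z. Qed.

Lemma cIm_conj z : Im z^* = - Im z. Proof. by case: z. Qed.

Lemma normc_conj z : normc z^* = normc z.
Proof. by case: z => a b /=; rewrite sqrrN. Qed.

Lemma complex_eqP z w : Re z = Re w -> Im z = Im w -> z = w.
Proof. by case: z w => a b [c e] /= -> ->. Qed.

Lemma conjC_real (a : R) : (a%:C%C)^* = a%:C%C :> R[i].
Proof. by apply: complex_eqP; rewrite ?cRe_conj// cIm_conj/= oppr0. Qed.

Lemma normcN z : normc (- z) = normc z.
Proof. by case: z => a b /=; rewrite !sqrrN. Qed.

Lemma mulr_conj z : z * z^* = (normc z ^+ 2)%:C.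
Proof.
rewrite normc_sqr; case: z => a b; apply/eqP; rewrite eq_complex /=.
by apply/andP; split; apply/eqP; ring.
Qed.

Lemma normc_mul_le z w : normc (z * w) <= normc z ^+ 2 + normc w ^+ 2.
Proof.
rewrite Normc.normcM; move: (normc z) (normc w) (normc_ge0 z) (normc_ge0 w).
by move=> a b a0 b0; have := sqr_ge0 (a - b); rewrite sqrrB; nra.
Qed.

End ComplexFacts.

Section ComplexIntegral.
Context d (T : measurableType d) (R : realType).
Variable mu : {measure set T -> \bar R}.
Implicit Types f g : T -> R[i].

Definition cintegrable f :=
  mu.-integrable [set: T] (EFin \o (Re \o f)) /\
  mu.-integrable [set: T] (EFin \o (Im \o f)).

Lemma cintegrable_cmeasurable f : cintegrable f -> cmeasurable f.
Proof.
by move=> [/integrableP[mr _] /integrableP[mi _]]; split; exact/measurable_EFinP.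
Qed.

Lemma cmeasurable_conj f : cmeasurable f -> cmeasurable (fun x => (f x)^*).
Proof.
move=> [mr mi]; split.
  by under eq_fun do rewrite cRe_conj.
by under eq_fun do rewrite cIm_conj; exact: measurableT_comp.
Qed.

Lemma cmeasurable_cst (c : R[i]) : cmeasurable (fun _ : T => c).
Proof. by split; exact: measurable_cst. Qed.

Lemma cmeasurableB f g : cmeasurable f -> cmeasurable g ->
  cmeasurable (fun x => f x - g x).
Proof.
move=> mf mg; rewrite (_ : (fun _ => _) = f + (fun x => - 1 * g x)).
  by apply: cmeasurableD => //; apply: cmeasurableM => //; exact: cmeasurable_cst.
by apply/funext => x; rewrite !fctE mulN1r.
Qed.

Lemma cmeasurable_real (h : T -> R) : measurable_fun [set: T] h ->
  cmeasurable (fun x => (h x)%:C).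
Proof. by move=> mh; split. Qed.

Lemma cintegrable_dominated f (g : T -> R) : cmeasurable f ->
  mu.-integrable [set: T] (EFin \o g) -> (forall x, normc (f x) <= g x) ->
  cintegrable f.
Proof.
move=> [mr mi] ig fg; split; apply: (le_integrable _ _ _ ig) => //;
    do ?exact/measurable_EFinP.
- move=> x _ /=; rewrite !lee_fin (le_trans (normr_Re_le _))//.
  by rewrite (le_trans (fg x))// ler_norm.
- move=> x _ /=; rewrite !lee_fin (le_trans (normr_Im_le _))//.
  by rewrite (le_trans (fg x))// ler_norm.
Qed.

Lemma integrable_normc f : cintegrable f ->
  mu.-integrable [set: T] (EFin \o (normc \o f)).
Proof.
move=> cf; have [ir ii] := cf.
have := integrableD measurableT (integrable_abse ir) (integrable_abse ii).
apply: le_integrable => //.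
  by apply/measurable_EFinP; exact/measurable_normc/cintegrable_cmeasurable.
move=> x _ /=; rewrite lee_fin ger0_norm ?normc_ge0// ger0_norm ?addr_ge0//.
exact: normc_le_ReIm.
Qed.

Lemma cintegrableD f g : cintegrable f -> cintegrable g ->
  cintegrable (fun x => f x + g x).
Proof.
move=> [fr fi] [gr gi]; split.
  rewrite (_ : _ \o _ = (EFin \o (Re \o f)) \+ (EFin \o (Re \o g)))%E.
    exact: integrableD.
  by apply/funext => x /=; rewrite cReD.
rewrite (_ : _ \o _ = (EFin \o (Im \o f)) \+ (EFin \o (Im \o g)))%E.
  exact: integrableD.
by apply/funext => x /=; rewrite cImD.
Qed.

Lemma cintegralD f g : cintegrable f -> cintegrable g ->
  cintegral mu (fun x => f x + g x) = cintegral mu f + cintegral mu g.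
Proof.
move=> [fr fi] [gr gi]; apply: complex_eqP => /=.
  by under eq_Rintegral do rewrite cReD; rewrite RintegralD.
by under eq_Rintegral do rewrite cImD; rewrite RintegralD.
Qed.

Lemma cintegrableZ c f : cintegrable f -> cintegrable (fun x => c * f x).
Proof.
move=> cf.
apply: (@cintegrable_dominated _ (fun x => normc c * normc (f x))).
- by apply: cmeasurableM; [exact: cmeasurable_cst|exact: cintegrable_cmeasurable].
- exact: (integrableZl measurableT (normc c) (integrable_normc cf)).
- by move=> x; rewrite Normc.normcM.
Qed.

Lemma cintegralZ c f : cintegrable f ->
  cintegral mu (fun x => c * f x) = c * cintegral mu f.
Proof.
move=> [fr fi]; have iZ (k : R) (h : T -> R) :
    mu.-integrable [set: T] (EFin \o h) ->
    mu.-integrable [set: T] (EFin \o (fun x => k * h x)).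
  exact: integrableZl.
apply: complex_eqP => /=.
  under eq_Rintegral do rewrite cReM.
  by rewrite cReM RintegralB ?RintegralZl//; exact: iZ.
under eq_Rintegral do rewrite cImM.
by rewrite cImM RintegralD ?RintegralZl//; exact: iZ.
Qed.

Lemma cintegral_conj f : cintegrable f ->
  cintegral mu (fun x => (f x)^*) = (cintegral mu f)^*.
Proof.
move=> [fr fi]; apply: complex_eqP => /=.
  by under eq_Rintegral do rewrite cRe_conj.
under eq_Rintegral do rewrite cIm_conj -mulN1r.
by rewrite RintegralZl// mulN1r.
Qed.

Lemma ae_eq_Rintegral (u v : T -> R) : measurable_fun [set: T] u ->
  measurable_fun [set: T] v -> (\forall x \ae mu, u x = v x) ->
  (\int[mu]_x u x = \int[mu]_x v x)%R.
Proof.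
move=> mf mg fg; rewrite /Rintegral; congr fine; apply: ae_eq_integral => //.
- exact/measurable_EFinP.
- exact/measurable_EFinP.
- by apply: filterS fg => x fgx _; rewrite /= fgx.
Qed.

Lemma ae_eq_cintegral f g : cmeasurable f -> cmeasurable g ->
  (\forall x \ae mu, f x = g x) -> cintegral mu f = cintegral mu g.
Proof.
move=> [fr fi] [gr gi] fg; apply: complex_eqP; apply: ae_eq_Rintegral => //;
  by apply: filterS fg => x ->.
Qed.

Lemma cintegrable_bndM f g (M : R) : cintegrable f -> cmeasurable g ->
  (forall x, normc (g x) <= M) -> cintegrable (fun x => f x * g x).
Proof.
move=> cf mg gM; apply: (@cintegrable_dominated _ (fun x => M * normc (f x))).
- by apply: cmeasurableM => //; exact: cintegrable_cmeasurable.
- exact: (integrableZl measurableT M (integrable_normc cf)).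
- by move=> x; rewrite Normc.normcM mulrC ler_wpM2r// normc_ge0.
Qed.

Lemma cintegral0 : cintegral mu (fun=> 0) = 0 :> R[i].
Proof.
by apply: complex_eqP => /=; rewrite Rintegral_cst// mul0r.
Qed.

End ComplexIntegral.

(** * Square integrals *)

Section SquareIntegral.
Context d (T : measurableType d) (R : realType).
Variable mu : {measure set T -> \bar R}.
Implicit Types f g h : T -> R[i].

Definition sqint f : \bar R := (\int[mu]_x (normc (f x) ^+ 2)%:E)%E.

Lemma sqint_ge0 f : (0 <= sqint f)%E.
Proof. by apply: integral_ge0 => x _; rewrite lee_fin sqr_ge0. Qed.

Lemma measurable_normc_sqr f : cmeasurable f ->
  measurable_fun [set: T] (fun x => (normc (f x) ^+ 2)%:E).
Proof.
by move=> mf; apply/measurable_EFinP/measurable_funX/measurable_normc.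
Qed.

Lemma cLnorm2E f : cLnorm mu 2%:E f = (sqint f `^ 2^-1)%E.
Proof.
rewrite /cLnorm unlock; congr (_ `^ _)%E; apply: eq_integral => x _ /=.
by rewrite ger0_norm ?normc_ge0// powR_mulrn ?normc_ge0.
Qed.

Lemma cLfun2P f : f \in cLfun mu 2%:E <-> cmeasurable f /\ (sqint f < +oo)%E.
Proof.
split=> [/cLfunP[mf]|[mf nf]].
  by rewrite cLnorm2E => nf; split => //; apply: lty_poweRy nf; rewrite invr_neq0.
by apply/cLfunP; split => //; rewrite cLnorm2E poweR_lty.
Qed.

(** The left norm is nonnegative, hence so is the right side, and the inequality may be multiplied
    by itself. Later estimates then need no square roots. *)
Lemma sqint_cLnorm_le f g (M : R) :
  (cLnorm mu 2%:E f <= M%:E * cLnorm mu 2%:E g)%E ->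
  (sqint f <= (M ^+ 2)%:E * sqint g)%E.
Proof.
rewrite !cLnorm2E => fg.
have sqK h : ((sqint h `^ 2^-1) ^+ 2 = sqint h)%E.
  by rewrite poweR12_sqrt ?sqint_ge0// sqr_sqrte// sqint_ge0.
rewrite -(sqK f) -(sqK g) EFin_expe !expe2 muleACA.
by apply: lee_pmul => //; exact: poweR_ge0.
Qed.

Lemma ae_eq_sqint f g : cmeasurable f -> cmeasurable g ->
  (\forall x \ae mu, f x = g x) -> sqint f = sqint g.
Proof.
move=> mf mg fg; apply: ae_eq_integral => //; try exact: measurable_normc_sqr.
by apply: filterS fg => x -> _.
Qed.

Lemma sqint_eq0 f : cmeasurable f -> (sqint f <= 0)%E ->
  \forall x \ae mu, f x = 0.
Proof.
move=> mf f0.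
have : ae_eq mu [set: T] (fun x => (normc (f x) ^+ 2)%:E) (cst 0%E).
  apply/ae_eq_integral_abs => //; first exact: measurable_normc_sqr.
  apply/eqP; rewrite eq_le integral_ge0// andbT (le_trans _ f0)//.
  rewrite le_eqVlt; apply/orP; left; apply/eqP; apply: eq_integral => x _.
  by rewrite gee0_abs// lee_fin sqr_ge0.
apply: filterS => x /(_ I)/= -[] /eqP; rewrite sqrf_eq0 => /eqP.
exact: Normc.eq0_normc.
Qed.

(** The majorant [|f|^2 + |g|^2] of [|f g|] takes the place of Hoelder's inequality. *)
Lemma cintegrable_mul f g : f \in cLfun mu 2%:E -> g \in cLfun mu 2%:E ->
  cintegrable mu (fun x => f x * g x).
Proof.
move=> /cLfun2P[mf ff] /cLfun2P[mg gf].
have isq h : cmeasurable h -> (sqint h < +oo)%E ->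
    mu.-integrable [set: T] (fun x => (normc (h x) ^+ 2)%:E).
  move=> mh fh; apply/integrableP; split; first exact: measurable_normc_sqr.
  apply: le_lt_trans fh; rewrite le_eqVlt; apply/orP; left; apply/eqP.
  by apply: eq_integral => x _; rewrite gee0_abs// lee_fin sqr_ge0.
apply: (@cintegrable_dominated _ _ _ _ _
  (fun x => normc (f x) ^+ 2 + normc (g x) ^+ 2)).
- exact: cmeasurableM.
- exact: (integrableD measurableT (isq _ mf ff) (isq _ mg gf)).
- by move=> x; exact: normc_mul_le.
Qed.

Lemma cLfun2_conj f : f \in cLfun mu 2%:E -> (fun x => (f x)^*) \in cLfun mu 2%:E.
Proof.
move=> /cLfun2P[mf ff]; apply/cLfun2P; split; first exact: cmeasurable_conj.
by rewrite /sqint; under eq_integral do rewrite normc_conj.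
Qed.

Lemma cinner_self f : f \in cLfun mu 2%:E ->
  cinner mu f f = (fine (sqint f))%:C.
Proof.
move=> /cLfun2P[mf ff]; apply: complex_eqP; rewrite /cinner /cintegral/=.
  by apply: eq_Rintegral => x _; rewrite mulr_conj.
under eq_Rintegral do rewrite mulr_conj/=.
by rewrite Rintegral_cst// mul0r.
Qed.

End SquareIntegral.

(** * Convergence of complex sequences *)

Section ComplexConvergence.
Context {R : realType}.
Implicit Types (u : nat -> R[i]) (l a : R[i]).

(** Stated through a real sequence, so that the limit theorems for real sequences apply directly. *)
Definition ccvg u l : Prop := (fun j => normc (u j - l)) @ \oo --> (0 : R).

Lemma ccvg_ReIm u l : (fun j => Re (u j)) @ \oo --> Re l ->
  (fun j => Im (u j)) @ \oo --> Im l -> ccvg u l.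
Proof.
move=> ul vl.
apply: (@squeeze_cvgr _ _ _ _ (cst 0)
  (fun j => `|Re (u j) - Re l| + `|Im (u j) - Im l|)).
- near=> j; rewrite normc_ge0/=; apply: (le_trans (normc_le_ReIm _)).
  by move: (u j) (l) => [? ?] [? ?].
- exact: cvg_cst.
- have H (v : nat -> R) (a : R) : v @ \oo --> a ->
      (fun j => `|v j - a|) @ \oo --> (0 : R).
    move=> va; rewrite -[X in _ --> X](@normr0 R R) -(subrr a).
    by apply: cvg_norm; apply: cvgB => //; exact: cvg_cst.
  by rewrite -[X in _ --> X](addr0 (0 : R)); apply: cvgD; exact: H.
Unshelve. all: by end_near. Qed.

Lemma ccvgMl a u l : ccvg u l -> ccvg (fun j => a * u j) (a * l).
Proof.
move=> ul; rewrite /ccvg; under eq_fun do rewrite -mulrBr Normc.normcM.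
by rewrite -(mulr0 (normc a)); apply: cvgM => //; exact: cvg_cst.
Qed.

Lemma ccvgBl a u l : ccvg u l -> ccvg (fun j => a - u j) (a - l).
Proof.
rewrite /ccvg => ul.
have N (z w : R[i]) : normc (a - z - (a - w)) = normc (z - w).
  by rewrite (_ : a - z - (a - w) = - (z - w)) ?normcN//; ring.
by under eq_fun do rewrite N.
Qed.

Lemma ccvgBr a u l : ccvg u l -> ccvg (fun j => u j - a) (l - a).
Proof.
rewrite /ccvg => ul.
have N (z w : R[i]) : normc (z - a - (w - a)) = normc (z - w).
  by congr normc; ring.
by under eq_fun do rewrite N.
Qed.

Lemma ccvg_normc u l : ccvg u l -> (fun j => normc (u j)) @ \oo --> normc l.
Proof.
move=> ul; apply/cvgrPdist_le => e e0.
move/cvgrPdist_le : ul => /(_ _ e0); apply: filterS => j.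
rewrite sub0r normrN ger0_norm ?normc_ge0//; apply: le_trans.
have H (z w : R[i]) : normc z - normc w <= normc (z - w).
  by rewrite lerBlDr; have := ler_normcD (z - w) w; rewrite subrK.
rewrite ler_norml; apply/andP; split; last first.
  by apply: (le_trans (H _ _)); rewrite -normcN opprB.
by rewrite lerNl opprB; exact: H.
Qed.

End ComplexConvergence.

(** * Fatou's lemma for square integrals *)

Section SquareIntegralLimits.
Context d (T : measurableType d) (R : realType).
Variable mu : {measure set T -> \bar R}.
Implicit Types f g h : T -> R[i].

(** Fatou's lemma for the functions [|g_j|^2], whose lower limit is almost everywhere a limit, equal
    to [|g|^2]. *)
Lemma sqint_fatou (g_ : nat -> T -> R[i]) g :
  (forall j, cmeasurable (g_ j)) -> cmeasurable g ->
  (\forall x \ae mu, ccvg (fun j => g_ j x) (g x)) ->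
  (sqint mu g <= limn_einf (fun j => sqint mu (g_ j)))%E.
Proof.
move=> mg_ mg gg.
apply: le_trans (fatou mu measurableT _ _); last first.
- by move=> n x _; rewrite lee_fin sqr_ge0.
- by move=> n; exact: measurable_normc_sqr.
rewrite le_eqVlt; apply/orP; left; apply/eqP; apply: ae_eq_integral => //.
- exact: measurable_normc_sqr.
- apply: measurableT_comp => //; apply: measurable_fun_limn_esup => n.
  by apply: measurableT_comp => //; exact: measurable_normc_sqr.
- apply: filterS gg => x gx _.
  apply/esym/(@cvg_limn_einf_sup _ _ _ _).1.
  apply: cvg_EFin; first exact: nearW.
  by apply: (cvgM (ccvg_normc gx) (ccvg_normc gx)).
Qed.

(** This is how every L2 bound below passes to an almost everywhere limit. *)
Lemma sqint_le_lim (g_ : nat -> T -> R[i]) g (C : \bar R) :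
  (forall j, cmeasurable (g_ j)) -> cmeasurable g ->
  (\forall x \ae mu, ccvg (fun j => g_ j x) (g x)) ->
  (\forall j \near \oo, (sqint mu (g_ j) <= C)%E) -> (sqint mu g <= C)%E.
Proof.
move=> mg_ mg gg gC; apply: (le_trans (sqint_fatou mg_ mg gg)).
rewrite limn_einf_lim; apply: lime_le; first exact: is_cvg_einfs.
near=> n; have [N _ NC] := gC.
(* The infimum over the indices from [n] on is at most the term [n + N], which is late enough for
   the bound to hold. *)
apply: (@le_trans _ _ (sqint mu (g_ (n + N)%N))); last first.
  by apply: NC => /=; rewrite leq_addl.
by apply: ereal_inf_lbound; exists (n + N)%N => //=; rewrite leq_addr.
Unshelve. all: by end_near. Qed.

End SquareIntegralLimits.

(** * Completeness of L2 over a finite measure *)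

Section RieszFischer.
Context d (T : measurableType d) (R : realType).
Variable mu : {finite_measure set T -> \bar R}.
Implicit Types f g h : T -> R[i].

(* On a finite measure space, [|f| <= e + |f|^2 / e] controls the L1 norm by
   the L2 norm without Hoelder's inequality. *)
Lemma integral_normc_le f (e : R) : cmeasurable f -> 0 < e ->
  (sqint mu f <= (e ^+ 2)%:E)%E ->
  (\int[mu]_x (normc (f x))%:E <= (e * (fine (mu [set: T]) + 1))%:E)%E.
Proof.
move=> mf e0 fe.
apply: (@le_trans _ _ (\int[mu]_x (e%:E + (e^-1 * normc (f x) ^+ 2)%:E))%E).
  apply: ge0_le_integral => //.
  - by move=> x _; rewrite lee_fin normc_ge0.
  - by apply/measurable_EFinP; exact: measurable_normc.
  - apply: emeasurable_funD => //; apply/measurable_EFinP.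
    by apply: measurable_funM => //; apply: measurable_funX; exact: measurable_normc.
  - move=> x _; rewrite -EFinD lee_fin; set a := normc _.
    have a0 : 0 <= a by exact: normc_ge0.
    rewrite -(ler_pM2l e0) mulrDr mulrA divff ?gt_eqF// mul1r.
    by have := sqr_ge0 (a - e); rewrite sqrrB; nra.
rewrite ge0_integralD//=; last 3 first.
- by move=> x _; rewrite lee_fin ltW.
- by move=> x _; rewrite lee_fin mulr_ge0// ?sqr_ge0// invr_ge0 ltW.
- apply/measurable_EFinP/measurable_funM => //.
  by apply: measurable_funX; exact: measurable_normc.
rewrite integral_cst//=.
under eq_integral do rewrite EFinM.
rewrite ge0_integralZl//; last 3 first.
- exact: measurable_normc_sqr.
- by move=> x _; rewrite lee_fin sqr_ge0.
- by rewrite lee_fin invr_ge0 ltW.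
rewrite mulrDr mulr1 EFinD EFinM fineK ?fin_num_measure//.
apply: leeD => //; apply: (le_trans (lee_pmul _ _ (lexx _) fe)).
- by rewrite lee_fin invr_ge0 ltW.
- exact: sqint_ge0.
- by rewrite -EFinM lee_fin expr2 mulKf// gt_eqF.
Qed.

(** By [integral_normc_le] with [e = 2^-j], the L1 norms are dominated by a geometric series. So the
    sum of the moduli has a finite integral, and is therefore finite almost everywhere. *)
Lemma ae_cvg_series_normc (f_ : nat -> T -> R[i]) :
  (forall j, cmeasurable (f_ j)) ->
  (forall j, (sqint mu (f_ j) <= ((2^-1 ^+ j) ^+ 2)%:E)%E) ->
  \forall x \ae mu, cvgn (series (fun j => normc (f_ j x))).
Proof.
move=> mf fle; pose C := fine (mu [set: T]) + 1.
have C0 : 0 <= C by rewrite addr_ge0// fine_ge0.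
have m_ j : measurable_fun [set: T] (fun x => (normc (f_ j x))%:E).
  by apply/measurable_EFinP; exact: measurable_normc.
have ge0_ j x : (0 <= (normc (f_ j x))%:E)%E by rewrite lee_fin normc_ge0.
pose F x : \bar R := (\sum_(j <oo) (normc (f_ j x))%:E)%E.
have F0 x : (0 <= F x)%E by apply: nneseries_ge0 => n _ _; exact: ge0_.
have mF : measurable_fun [set: T] F by exact: ge0_emeasurable_sum.
have iF : mu.-integrable [set: T] F.
  apply/integrableP; split => //.
  under eq_integral do rewrite gee0_abs//.
  rewrite integral_nneseries//.
  (* [C * 2] is the sum of the geometric series with terms [C * 2^-j]. *)
  apply: (@le_lt_trans _ _ (C * 2)%:E); last by rewrite ltry.
  apply: lime_le.
    by apply: is_cvg_nneseries => n _ _; apply: integral_ge0 => x _; exact: ge0_.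
  near=> n.
  apply: (@le_trans _ _ (series (geometric C 2^-1) n)%:E); last first.
    rewrite lee_fin (le_trans (geometric_le_lim _ _ _ _))//; last 2 first.
    - by rewrite ger0_norm// invf_lt1// ltr1n.
    - by rewrite (_ : (1 - 2^-1)^-1 = 2 :> R)//; field.
  rewrite /series/= -sumEFin; apply: lee_sum => k _.
  by rewrite mulrC; apply: integral_normc_le => //; rewrite exprn_gt0.
have := integrable_ae measurableT iF; apply: filterS => x /(_ I) Ffin.
have : (fun n => \sum_(0 <= j < n) (normc (f_ j x))%:E)%E @ \oo --> F x.
  by apply: is_cvg_nneseries => n _ _; exact: ge0_.
rewrite -(fineK Ffin) => /fine_cvg FF.
apply/cvg_ex; exists (fine (F x)); apply: cvg_trans FF.
apply: near_eq_cvg; near=> n.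
by rewrite /= /series/= sumEFin.
Unshelve. all: by end_near. Qed.

(* A.e. convergence in the completeness of L2 comes from the absolute
   convergence of the telescoping series of a fast Cauchy sequence. *)
Lemma riesz_fischer (u_ : nat -> T -> R[i]) :
  (forall j, cmeasurable (u_ j)) ->
  (forall j k, (j <= k)%N ->
    (sqint mu (fun x => u_ k x - u_ j x)%R <= ((2^-1 ^+ j) ^+ 2)%:E)%E) ->
  exists h, [/\ cmeasurable h, (\forall x \ae mu, ccvg (fun j => u_ j x) (h x)) &
    forall j, (sqint mu (fun x => h x - u_ j x)%R <= ((2^-1 ^+ j) ^+ 2)%:E)%E].
Proof.
move=> mu_ uC.
(* The upper limit is defined and measurable at every point, also where the sequence diverges; it is
   the limit wherever there is one. *)
pose lre x := fine (limn_esup (fun j => (Re (u_ j x))%:E)).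
pose lim x := fine (limn_esup (fun j => (Im (u_ j x))%:E)).
pose h x : R[i] := lre x +i* lim x.
have mh : cmeasurable h.
  have ml (P : R[i] -> R) : (forall n, measurable_fun [set: T] (P \o u_ n)) ->
      measurable_fun [set: T] (fun x => fine (limn_esup (fun j => (P (u_ j x))%:E))).
    move=> mP; apply: measurableT_comp => //.
    by apply: measurable_fun_limn_esup => n; apply/measurable_EFinP; exact: mP.
  by split; apply: ml => n; case: (mu_ n).
have uh : \forall x \ae mu, ccvg (fun j => u_ j x) (h x).
  have := @ae_cvg_series_normc (fun j x => u_ j.+1 x - u_ j x)
    (fun j => cmeasurableB (mu_ _) (mu_ _)) (fun j => uC j j.+1 (leqnSn j)).
  apply: filterS => x cx.
  have cv (P : R[i] -> R) (PB : {morph P : z w / z - w})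
      (Ple : forall z, `|P z| <= normc z) :
      (fun j => P (u_ j x)) @ \oo --> fine (limn_esup (fun j => (P (u_ j x))%:E)).
    have /cvg_ex[l ul] : cvgn (fun j => P (u_ j x)).
      have : cvgn (series (fun j => P (u_ j.+1 x) - P (u_ j x))).
        apply: normed_cvg; apply: series_le_cvg cx => j //=; first exact: normc_ge0.
        by rewrite -PB; exact: Ple.
      move=> /cvg_ex[l sl]; apply/cvg_ex; exists (P (u_ 0 x) + l).
      rewrite (_ : (fun j => _) = (fun j => P (u_ 0 x) +
          series (telescope (fun j => P (u_ j x))) j)).
        by apply: cvgD; [exact: cvg_cst|exact: sl].
      by apply/funext => j; rewrite -eq_sum_telescope.
    have /cvg_limn_einf_sup[_ ->] : (fun j => (P (u_ j x))%:E) @ \oo --> l%:E.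
      by apply: cvg_EFin ul; exact: nearW.
    by [].
  apply: ccvg_ReIm.
  - by apply: cv; [move=> [? ?] [? ?]|exact: normr_Re_le].
  - by apply: cv; [move=> [? ?] [? ?]|exact: normr_Im_le].
exists h; split => // j.
(* With [j] fixed, Fatou's lemma in [k] carries the Cauchy bound over to the limit. *)
apply: (@sqint_le_lim _ _ _ _ (fun k x => u_ k x - u_ j x)).
- by move=> k; exact: cmeasurableB.
- exact: cmeasurableB.
- by apply: filterS uh => x ux; exact: ccvgBr.
- by exists j => // k /= jk; exact: uC.
Qed.

End RieszFischer.

(** * Integrals on the circle *)

Section CircleIntegral.
Variable R : realType.
Local Notation mu := (@circle_measure R).

Lemma circle_neq0 (z : circle R) : val z != 0.
Proof. by rewrite -normr_eq0 (eqP (valP z)) oner_eq0. Qed.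

Lemma monomialD m n (z : circle R) :
  monomial (m + n) z = monomial m z * monomial n z.
Proof. by rewrite /monomial expfzDr// circle_neq0. Qed.

Lemma monomial0 (z : circle R) : monomial 0 z = 1.
Proof. by rewrite /monomial expr0z. Qed.

Lemma monomial_conj n (z : circle R) : (monomial n z)^* = monomial (- n) z.
Proof. by rewrite monomialV. Qed.

Lemma monomial_mul_conj m n (z : circle R) :
  monomial m z * (monomial n z)^* = monomial (m - n) z.
Proof. by rewrite monomial_conj -monomialD. Qed.

(** De Moivre's formula, from which explicit primitives of both coordinates are found. *)
Lemma monomial_cis (k : nat) (t : R) :
  monomial k (cis t) = cos (k%:R * t) +i* sin (k%:R * t).
Proof.
elim: k => [|k IHk]; first by rewrite monomial0 mul0r cos0 sin0.
rewrite -addn1 PoszD monomialD IHk /monomial expr1z natrD mulrDl mul1r cosD sinD.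
by apply: complex_eqP; rewrite ?cReM ?cImM/=; ring.
Qed.

Lemma Rintegral_circle1 : (\int[mu]_z (1 : R))%R = 1.
Proof.
rewrite Rintegral_cst// mul1r -[RHS]/(fine 1%:E); congr fine.
exact: probability_setT.
Qed.

(* The formula for the uniform law is only available for nonnegative
   integrands, hence the shift by 1. *)
Lemma Rintegral_circle_deriv (g : circle R -> R) (F f : R -> R) :
  measurable_fun [set: circle R] g -> (forall z, `|g z| <= 1) ->
  (forall t, g (cis t) = f t) -> continuous f ->
  (forall t : R, is_derive t (1 : R) F (f t)) -> F (2 * pi) = F 0 ->
  (\int[mu]_z g z)%R = 0.
Proof.
move=> mg g1 gf cf dF FE.
have ig : mu.-integrable [set: circle R] (EFin \o g).
  apply: measurable_bounded_integrable => //.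
    by rewrite (le_lt_trans (probability_le1 _ _))// ltry.
  exists 1; split; first exact: num_real.
  by move=> M M1 z _; exact: (le_trans (g1 z) (ltW M1)).
have i1 : mu.-integrable [set: circle R] (EFin \o (fun=> 1 : R)).
  exact: finite_measure_integrable_cst.
have g0 z : 0 <= 1 + g z by have := g1 z; rewrite ler_norml; lra.
have mg1 : measurable_fun [set: circle R] (fun z => (1 + g z)%:E).
  by apply/measurable_EFinP; exact: measurable_funD.
have E : (\int[mu]_z (1 + g z))%R = 1.
  rewrite /Rintegral ge0_integral_distribution; last 2 first.
  - exact: mg1.
  - by move=> z; rewrite lee_fin.
  rewrite integral_uniform; last 2 first.
  - exact: (measurableT_comp mg1 (@measurable_cis R)).
  - by move=> t; rewrite lee_fin.
  under eq_integral do rewrite /= gf.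
  (* The primitive [t + F t] of [1 + f t] grows by exactly [2 * pi] over the period, because [F]
     takes the same value at both ends. *)
  rewrite (@continuous_FTC2 _ _ (fun t => t + F t)).
  - rewrite FE -EFinB -EFinM /=.
    by rewrite (addrC 0) addrKA !subr0 mulVf// gt_eqF// twopi_gt0.
  - exact: twopi_gt0.
  - apply: continuous_subspaceT => t.
    by apply: continuousD; [exact: cst_continuous|exact: cf].
  - pose G (t : R) : R := t + F t.
    have dG (t : R) : derivable G t (1 : R) by exact: derivableD.
    have cG (t : R) : {for t, continuous G}.
      exact/differentiable_continuous/derivable1_diffP.
    split.
    + by move=> t _; exact: dG.
    + exact: cvg_at_right_filter (cG _).
    + exact: cvg_at_left_filter (cG _).
  - move=> t _; rewrite derive1E deriveD//.
    by rewrite derive_id derive_val.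
move: E; rewrite RintegralD// Rintegral_circle1 => /eqP.
by rewrite -subr_eq0 addrAC subrr add0r => /eqP.
Qed.

Lemma cintegrable_monomial n : cintegrable mu (@monomial R n).
Proof.
apply: (@cintegrable_dominated _ _ _ _ _ (cst 1)).
- exact: cmeasurable_monomial.
- exact: finite_measure_integrable_cst.
- by move=> z; rewrite normc_monomial.
Qed.

(** For positive exponents both coordinates have periodic primitives, [sin (k t) / k] and
    [- cos (k t) / k]; negative exponents follow by conjugation. *)
Lemma cintegral_monomial n : cintegral mu (@monomial R n) = (n == 0)%:R.
Proof.
have pos (k : nat) : cintegral mu (@monomial R k.+1) = 0.
  have [mr mi] := cmeasurable_monomial R k.+1.
  have k0 : k.+1%:R != 0 :> R by rewrite pnatr_eq0.
  have npiE : k.+1%:R * (2 * pi) = 0 + pi *+ 2 *+ k.+1 :> R.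
    by rewrite !mulr_natl add0r.
  have sin2npi : sin (k.+1%:R * (2 * pi)) = 0 :> R.
    by rewrite npiE (periodicn (@sinD2pi R)) sin0.
  have cos2npi : cos (k.+1%:R * (2 * pi)) = 1 :> R.
    by rewrite npiE (periodicn (@cosD2pi R)) cos0.
  have ck : continuous (fun t : R => k.+1%:R * t).
    exact: mulrl_continuous.
  apply: complex_eqP.
  - apply: (@Rintegral_circle_deriv (fun z => Re (monomial k.+1 z))
      (fun t => k.+1%:R^-1 * sin (k.+1%:R * t))
      (fun t => cos (k.+1%:R * t))) => //.
    + by move=> z; rewrite -[leRHS](normc_monomial k.+1 z); exact: normr_Re_le.
    + by move=> t; rewrite monomial_cis.
    + by move=> t; apply: continuous_comp; [exact: ck|exact: continuous_cos].
    + move=> t; apply: is_derive_eq.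
      by rewrite /GRing.scale/= mulr1 mulrCA mulVf// mulr1.
    + by rewrite sin2npi !mulr0 sin0 mulr0.
  - apply: (@Rintegral_circle_deriv (fun z => Im (monomial k.+1 z))
      (fun t => - (k.+1%:R^-1 * cos (k.+1%:R * t)))
      (fun t => sin (k.+1%:R * t))) => //.
    + by move=> z; rewrite -[leRHS](normc_monomial k.+1 z); exact: normr_Im_le.
    + by move=> t; rewrite monomial_cis.
    + by move=> t; apply: continuous_comp; [exact: ck|exact: continuous_sin].
    + move=> t; apply: is_derive_eq.
      by rewrite /GRing.scale/= mulr1 mulNr mulrN opprK mulrCA mulVf// mulr1.
    + by rewrite cos2npi !mulr0 cos0.
case: n => [[|k]|k].
- rewrite (_ : @monomial R 0 = fun=> 1); last first.
    by apply/funext => z; rewrite monomial0.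
  apply: complex_eqP => /=; first exact: Rintegral_circle1.
  by rewrite Rintegral_cst// mul0r.
- exact: pos.
- rewrite NegzE (_ : monomial _ = fun z => (@monomial R k.+1 z)^*); last first.
    by apply/funext => z; rewrite monomial_conj.
  by rewrite (cintegral_conj (cintegrable_monomial k.+1)) pos rmorph0.
Qed.

Lemma monomial_Linfty n : @monomial R n \in cLfun mu +oo%E.
Proof.
apply/cLfunP; split; first exact: cmeasurable_monomial.
rewrite /cLnorm (_ : (fun x => _) = cst 1); last first.
  by apply/funext => z; rewrite normc_monomial.
rewrite unlock; case: ifPn => // _.
apply: (@le_lt_trans _ _ 1%:E); last by rewrite ltry.
by apply/ess_supP; apply: aeW => z /=; rewrite normr1.
Qed.

End CircleIntegral.

(** * Uniqueness of Fourier coefficients *)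

Section SignIteration.
Variable R : realType.
Implicit Types s t : R.

(* A polynomial mapping [-1, 1] to itself whose iterates converge to the sign
   function. *)
Definition sign_step s : R := (3 * s - s ^+ 3) / 2.

Lemma sign_stepN s : sign_step (- s) = - sign_step s.
Proof. by rewrite /sign_step; field. Qed.

Lemma sign_step_bounds s : 0 <= s <= 1 -> s <= sign_step s <= 1.
Proof.
move=> /andP[s0 s1].
have e1 : sign_step s - s = s * (1 - s) * (1 + s) / 2 by rewrite /sign_step; field.
have e2 : 1 - sign_step s = (1 - s) ^+ 2 * (2 + s) / 2.
  by rewrite /sign_step; field.
have s1' : 0 <= 1 - s by rewrite subr_ge0.
have d1 : 0 <= 1 + s by rewrite addr_ge0.
have d2 : 0 <= 2 + s by rewrite addr_ge0.
apply/andP; split; rewrite -subr_ge0 ?e1 ?e2 divr_ge0//.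
  by rewrite !mulr_ge0.
by rewrite mulr_ge0// sqr_ge0.
Qed.

Lemma iter_sign_stepN n s : iter n sign_step (- s) = - iter n sign_step s.
Proof. by elim: n => // n IHn; rewrite !iterS IHn sign_stepN. Qed.

Lemma iter_sign_step_bounds n s : 0 <= s <= 1 ->
  s <= iter n sign_step s <= 1.
Proof.
move=> s01; elim: n => [|n /andP[sn n1]] /=.
  by case/andP: s01 => _ ->; rewrite lexx.
have /andP[s0 _] := s01.
have /sign_step_bounds/andP[h ->] : 0 <= iter n sign_step s <= 1.
  by rewrite (le_trans s0 sn).
by rewrite (le_trans sn h).
Qed.

Lemma iter_sign_step_norm_le1 n s : `|s| <= 1 -> `|iter n sign_step s| <= 1.
Proof.
have pos t : 0 <= t -> `|t| <= 1 -> `|iter n sign_step t| <= 1.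
  move=> t0; rewrite ger0_norm// => t1.
  have /(iter_sign_step_bounds n)/andP[h1 h2] : 0 <= t <= 1 by rewrite t0.
  by rewrite ger0_norm// (le_trans t0).
move=> s1; have [s0|/ltW s0] := leP 0 s; first exact: pos.
by rewrite -normrN -iter_sign_stepN; apply: pos; rewrite ?oppr_ge0 ?normrN.
Qed.

(** For [0 < t <= 1] the orbit is nondecreasing and bounded by 1, so by continuity its limit is a
    fixed point of [sign_step]. The fixed points are -1, 0 and 1, and the limit is at least [t].
    Negative arguments follow by oddness. *)
Lemma cvg_iter_sign_step s : `|s| <= 1 ->
  (fun n => iter n sign_step s) @ \oo --> Num.sg s.
Proof.
have pos t : 0 < t -> t <= 1 -> (fun n => iter n sign_step t) @ \oo --> (1 : R).
  move=> t0 t1; set u := fun n => _.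
  have t01 : 0 <= t <= 1 by rewrite ltW.
  have ub n : t <= u n <= 1 by exact: iter_sign_step_bounds.
  have nd : nondecreasing_seq u.
    apply/nondecreasing_seqP => n; have /andP[h1 h2] := ub n.
    have /sign_step_bounds/andP[] // : 0 <= u n <= 1.
    by rewrite (le_trans (ltW t0) h1).
  have cu : cvgn u.
    apply: nondecreasing_is_cvgn => //; exists 1 => _ [n _ <-].
    by have /andP[] := ub n.
  have ul : u @ \oo --> limn u by [].
  have tl : t <= limn u.
    by apply: limr_ge => //; apply: nearW => n; have /andP[] := ub n.
  have lE : limn u = sign_step (limn u).
    apply: (@cvg_unique _ _ (u n.+1 @[n --> \oo])) => //.
      by have := ul; rewrite -cvg_shiftS.
    apply: (@cvgM _ _ _ _ (fun n => 3 * u n - u n ^+ 3) (cst 2^-1)).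
      apply: cvgB; last exact: (cvg_comp _ _ ul (@exprn_continuous R 3 _)).
      by apply: cvgM => //; exact: cvg_cst.
    exact: cvg_cst.
  suff l1 : limn u = 1 by rewrite -l1.
  have l0 : 0 < limn u by exact: lt_le_trans tl.
  have : limn u * ((limn u - 1) * (limn u + 1)) = 0.
    move: lE; rewrite /sign_step; move: (limn u) => l lE.
    have : 2 * l = 3 * l - l ^+ 3 by rewrite [in LHS]lE; field.
    by rewrite exprS expr2; nra.
  move/eqP; rewrite !mulf_eq0 gt_eqF//= => /orP[|].
    by rewrite subr_eq0 => /eqP.
  by rewrite gt_eqF// addr_gt0.
move=> s1; have [s0|s0|<-] := ltgtP 0 s.
- by rewrite gtr0_sg//; apply: pos => //; rewrite -(gtr0_norm s0).
- rewrite ltr0_sg// -[s]opprK.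
  under eq_fun do rewrite iter_sign_stepN.
  by apply: cvgN; apply: pos; rewrite ?oppr_gt0// -(ltr0_norm s0).
- rewrite sgr0 (_ : (fun n => _) = cst 0); first exact: cvg_cst.
  apply/funext => n; elim: n => //= n ->.
  by rewrite /sign_step; field.
Qed.

End SignIteration.

Section FourierUniqueness.
Variable R : realType.
Local Notation mu := (@circle_measure R).
Implicit Types (f : circle R -> R[i]) (g h : circle R -> R).

(** Pairing with [monomial n] instead of its conjugate only changes the sign of [n], which runs over
    all integers. *)
Definition fourier_null f := cintegrable mu f /\
  forall n : int, cintegral mu (fun z => f z * monomial n z) = 0.

Definition null_multiplier g :=
  [/\ measurable_fun [set: circle R] g, exists M, forall z, `|g z| <= M &
    forall f, fourier_null f -> fourier_null (fun z => f z * (g z)%:C%C)].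

Lemma normc_real (a : R) : normc a%:C%C = `|a|.
Proof. by rewrite /= expr0n/= addr0 sqrtr_sqr. Qed.

Lemma cintegrableM_real f g (M : R) : cintegrable mu f ->
  measurable_fun [set: circle R] g -> (forall z, `|g z| <= M) ->
  cintegrable mu (fun z => f z * (g z)%:C%C).
Proof.
move=> cf mg gM; apply: (@cintegrable_bndM _ _ _ _ _ _ M) => //.
by move=> z; rewrite normc_real.
Qed.

Lemma cintegrableM_monomial f n : cintegrable mu f ->
  cintegrable mu (fun z => f z * monomial n z).
Proof.
move=> cf; apply: (@cintegrable_bndM _ _ _ _ _ _ 1) => //.
  exact: cmeasurable_monomial.
by move=> z; rewrite normc_monomial.
Qed.

Lemma null_multiplierM g h : null_multiplier g -> null_multiplier h ->
  null_multiplier (fun z => g z * h z).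
Proof.
move=> [mg [M gM] Ng] [mh [N hN] Nh]; split.
- exact: measurable_funM.
- by exists (M * N) => z; rewrite normrM ler_pM.
- move=> f /Ng/Nh; congr fourier_null; apply/funext => z.
  by rewrite rmorphM/= mulrA.
Qed.

Lemma fourier_null_lin (a b : R[i]) f1 f2 : fourier_null f1 -> fourier_null f2 ->
  fourier_null (fun z => a * f1 z + b * f2 z).
Proof.
move=> [c1 n1] [c2 n2]; split.
  by apply: cintegrableD; exact: cintegrableZ.
move=> n; under eq_fun do rewrite mulrDl -!mulrA.
rewrite cintegralD ?cintegralZ ?n1 ?n2 ?mulr0 ?addr0//;
  by [exact: cintegrableM_monomial|apply: cintegrableZ; exact: cintegrableM_monomial].
Qed.

Lemma null_multiplier_lin (a b : R) g h : null_multiplier g -> null_multiplier h ->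
  null_multiplier (fun z => a * g z + b * h z).
Proof.
move=> [mg [M gM] Ng] [mh [N hN] Nh]; split.
- by apply: measurable_funD; exact: measurable_funM.
- exists (`|a| * M + `|b| * N) => z; rewrite (le_trans (ler_normD _ _))//.
  by rewrite !normrM lerD// ler_wpM2l.
- move=> f f0; have := fourier_null_lin a%:C%C b%:C%C (Ng _ f0) (Nh _ f0).
  congr fourier_null; apply/funext => z.
  by rewrite rmorphD !rmorphM/=; ring.
Qed.

Lemma null_multiplier_cst (a : R) : null_multiplier (fun=> a).
Proof.
split; first exact: measurable_cst.
  by exists `|a|.
move=> f f0; have := fourier_null_lin a%:C%C 0 f0 f0.
by congr fourier_null; apply/funext => z; rewrite mul0r addr0 mulrC.
Qed.

Lemma fourier_null_monomial f n : fourier_null f ->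
  fourier_null (fun z => f z * monomial n z).
Proof.
move=> [cf f0]; split; first exact: cintegrableM_monomial.
by move=> m; under eq_fun do rewrite -mulrA -monomialD; exact: f0.
Qed.

(** On the circle [Re z = (z + z^-1) / 2], and multiplying by a power of [z] only shifts the Fourier
    coefficients. *)
Lemma null_multiplier_Re : null_multiplier (fun z => Re (val z)).
Proof.
have [mr _] := cmeasurable_monomial R 1.
split; first exact: mr.
  exists 1 => z; rewrite -[leRHS](normc_monomial 1 z); exact: normr_Re_le.
move=> f f0.
have := fourier_null_lin 2^-1 2^-1 (fourier_null_monomial 1 f0)
  (fourier_null_monomial (-1) f0).
congr fourier_null; apply/funext => z.
rewrite -monomial_conj /monomial expr1z.
rewrite -!mulrDr mulrCA; congr (_ * _).
case: (val z) => a b; apply/eqP; rewrite eq_complex/=; apply/andP.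
by split; apply/eqP; field.
Qed.

(** Likewise with [Im z = (- i z + i z^-1) / 2]. *)
Lemma null_multiplier_Im : null_multiplier (fun z => Im (val z)).
Proof.
have [_ mi] := cmeasurable_monomial R 1.
split; first exact: mi.
  exists 1 => z; rewrite -[leRHS](normc_monomial 1 z); exact: normr_Im_le.
move=> f f0.
have := fourier_null_lin (- 'i / 2) ('i / 2) (fourier_null_monomial 1 f0)
  (fourier_null_monomial (-1) f0).
congr fourier_null; apply/funext => z.
rewrite -monomial_conj /monomial expr1z.
rewrite (mulrCA _ (f z)) (mulrCA _ (f z)) -mulrDr; congr (_ * _).
case: (val z) => a b; apply/eqP; rewrite eq_complex/=; apply/andP.
by split; apply/eqP; field.
Qed.

(** Dominated convergence with majorant [M * |u|]. *)
Lemma Rintegral_mul_lim0 (u : circle R -> R) (g_ : nat -> circle R -> R) g (M : R) :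
  mu.-integrable [set: circle R] (EFin \o u) ->
  (forall j, measurable_fun [set: circle R] (g_ j)) ->
  (forall j z, `|g_ j z| <= M) ->
  (forall z, (fun j => g_ j z) @ \oo --> g z) ->
  (forall j, (\int[mu]_z (u z * g_ j z))%R = 0) ->
  (\int[mu]_z (u z * g z))%R = 0.
Proof.
move=> iu mg_ gM gg u0.
have mg : measurable_fun [set: circle R] g.
  by apply: (measurable_fun_cvg mg_) => z _; exact: gg.
have mu_ : measurable_fun [set: circle R] u.
  by case/integrableP : iu => /measurable_EFinP.
have M0 : 0 <= M by rewrite (le_trans _ (gM 0%N point)).
have iuM : mu.-integrable [set: circle R] (EFin \o (fun z => M * `|u z|)).
  exact: (integrableZl measurableT M (integrable_norm iu)).
have := @dominated_cvg _ _ _ mu _ measurableT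
  (fun j z => (u z * g_ j z)%:E) (fun z => (u z * g z)%:E) _ _ _ _ iuM _.
move=> H; rewrite /Rintegral.
(* A real integral equal to 0 could come from an infinite extended one, which [fine] also sends to
   0; integrability excludes this. *)
have I0 j : (\int[mu]_z (u z * g_ j z)%:E)%E = 0%E.
  have ij : mu.-integrable [set: circle R] (EFin \o (fun z => u z * g_ j z)).
    apply: le_integrable iuM => //.
      by apply/measurable_EFinP/measurable_funM.
    move=> z _ /=; rewrite lee_fin normrM mulrC (le_trans _ (ler_norm _))//.
    by rewrite ler_wpM2r.
  have := u0 j; rewrite /Rintegral => E; rewrite -[LHS]fineK ?E//.
  exact: integrable_fin_num.
suff -> : (\int[mu]_z (u z * g z)%:E)%E = 0%E by [].
apply: (@cvg_unique _ _ ((fun=> 0%E : \bar R) @ \oo)) => //; last exact: cvg_cst.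
rewrite -[X in X @ _](_ : (fun j => \int[mu]_z (u z * g_ j z)%:E)%E = _); last first.
  exact/funext.
apply: H.
- by move=> j; apply/measurable_EFinP/measurable_funM.
- move=> z _; apply: cvg_EFin; first exact: nearW.
  by apply: cvgMr; exact: gg.
- by [].
- move=> j z _ /=; rewrite lee_fin normrM mulrC ler_wpM2r//.
Qed.

(** Each Fourier coefficient of [f * g_j] vanishes, and a real factor moves out of [Re] and [Im], so
    dominated convergence applies to the two coordinates separately. *)
Lemma null_multiplier_cvg (g_ : nat -> circle R -> R) g (M : R) :
  (forall j, null_multiplier (g_ j)) -> (forall j z, `|g_ j z| <= M) ->
  (forall z, (fun j => g_ j z) @ \oo --> g z) -> null_multiplier g.
Proof.
move=> Ng_ gM gg.
have mg_ j : measurable_fun [set: circle R] (g_ j) by case: (Ng_ j).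
have mg : measurable_fun [set: circle R] g.
  by apply: (measurable_fun_cvg mg_) => z _; exact: gg.
have gM' z : `|g z| <= M.
  apply: (@closed_cvg _ _ \oo _ (fun j => `|g_ j z|) [set x | x <= M]).
  - exact: closed_le.
  - by apply: nearW => j; exact: gM.
  - by apply: cvg_norm; exact: gg.
split => //; first by exists M.
move=> f f0; split; first by apply: (cintegrableM_real f0.1 mg gM').
move=> n; have [ir ii] := cintegrableM_monomial n f0.1.
have RE (h : circle R -> R) z :
    Re (f z * (h z)%:C%C * monomial n z) = Re (f z * monomial n z) * h z.
  by rewrite mulrAC cReM_real.
have IE (h : circle R -> R) z :
    Im (f z * (h z)%:C%C * monomial n z) = Im (f z * monomial n z) * h z.
  by rewrite mulrAC cImM_real.
have E j : cintegral mu (fun z => f z * (g_ j z)%:C%C * monomial n z) = 0.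
  by case: (Ng_ j) => _ _ /(_ f f0)[_ ->].
apply: complex_eqP.
- rewrite -[LHS]/(\int[mu]_z (Re (f z * (g z)%:C%C * monomial n z)))%R.
  under eq_Rintegral do rewrite RE.
  apply: (Rintegral_mul_lim0 ir mg_ gM gg) => j.
  under eq_Rintegral do rewrite -RE.
  exact: (congr1 Re (E j)).
- rewrite -[LHS]/(\int[mu]_z (Im (f z * (g z)%:C%C * monomial n z)))%R.
  under eq_Rintegral do rewrite IE.
  apply: (Rintegral_mul_lim0 ii mg_ gM gg) => j.
  under eq_Rintegral do rewrite -IE.
  exact: (congr1 Im (E j)).
Qed.

Lemma null_multiplier_sg g : null_multiplier g ->
  null_multiplier (fun z => Num.sg (g z)).
Proof.
move=> Ng; have [_ [M gM] _] := Ng.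
(* The factor [c] brings [g] into [-1, 1], where the iteration converges; being positive, it
   preserves the sign. *)
pose c := (`|M| + 1)^-1; have c0 : 0 < c by rewrite invr_gt0 ltr_wpDl.
pose s z := c * g z.
have s1 z : `|s z| <= 1.
  rewrite normrM gtr0_norm// mulrC ler_pdivrMr ?ltr_wpDl// mul1r.
  by rewrite (le_trans (gM z))// (le_trans (ler_norm _))// lerDl.
apply: (@null_multiplier_cvg (fun j z => iter j (@sign_step R) (s z)) _ 1).
- elim=> [|j IHj] /=.
    have := null_multiplier_lin c 0 Ng Ng.
    by congr null_multiplier; apply/funext => z; rewrite mul0r addr0.
  have := null_multiplier_lin (3 / 2) (- 2^-1) IHj
    (null_multiplierM (null_multiplierM IHj IHj) IHj).
  congr null_multiplier; apply/funext => z; rewrite /sign_step.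
  by field.
- by move=> j z; exact: iter_sign_step_norm_le1.
- move=> z; rewrite -[Num.sg (g z)](_ : Num.sg (s z) = _).
    exact: cvg_iter_sign_step.
  by rewrite sgrM gtr0_sg// mul1r.
Qed.

Definition null_multiplier_set (E : set (circle R)) :=
  measurable E /\ null_multiplier (\1_E : circle R -> R).

(** With [s] the sign of [g - a], the polynomial [(s^2 + s) / 2] is 1 for [s = 1] and 0 for [s = 0]
    and [s = -1]. *)
Lemma null_multiplier_set_gt g (a : R) : null_multiplier g ->
  null_multiplier_set [set z | a < g z].
Proof.
move=> Ng; split.
  have [mg _ _] := Ng.
  rewrite (_ : [set _ | _] = setT `&` g @^-1` `]a, +oo[%classic); first exact: mg.
  by rewrite setTI; apply/seteqP; split => z /=; rewrite in_itv/= andbT.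
have Ns := null_multiplier_sg
  (null_multiplier_lin 1 (- a) Ng (null_multiplier_cst 1)).
have := null_multiplier_lin 2^-1 2^-1 (null_multiplierM Ns Ns) Ns.
congr null_multiplier; apply/funext => z.
rewrite mul1r mulr1 indicE.
have [az|az|az] := ltgtP a (g z).
- by rewrite mem_set// gtr0_sg ?subr_gt0//= !mulr1; field.
- rewrite memNset/=; last by rewrite ltNge ltW.
  by rewrite ltr0_sg ?subr_lt0//= mulrNN mulrN !mulr1 subrr.
- rewrite memNset/=; last by rewrite az ltxx.
  by rewrite az subrr sgr0 !mulr0 addr0.
Qed.

(** Stability under proper differences, increasing unions and intersections is enough. On indicators
    these operations are the difference, the bounded pointwise limit and the product. *)
Lemma sigma_algebra_null_multiplier :
  sigma_algebra [set: circle R] null_multiplier_set.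
Proof.
apply/sigma_algebraP => //; split.
- split; first exact: measurableT.
  by rewrite indicT; exact: null_multiplier_cst.
- move=> A B BA [mA NA] [mB NB]; split; first exact: measurableD.
  have := null_multiplier_lin 1 (-1) NA NB.
  congr null_multiplier; apply/funext => z.
  rewrite mul1r mulN1r !indicE in_setD.
  have [zB|zB] := boolP (z \in B); last by rewrite subr0 andbT.
  by rewrite mem_set ?subrr//; apply: BA; exact: set_mem.
- move=> F ndF NF; split.
    by apply: bigcupT_measurable => n; case: (NF n).
  apply: (@null_multiplier_cvg (fun j => \1_(F j)) _ 1).
  + by move=> j; case: (NF j).
  + by move=> j z; rewrite indicE ger0_norm// lern1; case: (_ \in _).
  (* At each point the indicators of an increasing sequence of sets are eventually constant. *)
  + move=> z; apply: cvg_near_cst.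
    have [[k _ Fkz]|nF] := pselect ((\bigcup_n F n) z).
      exists k => // n /= kn; rewrite !indicE !mem_set//; first by exists k.
      by move/subsetPset : (ndF _ _ kn) => /(_ _ Fkz).
    apply: nearW => n; rewrite !indicE !memNset// => Fnz.
    by apply: nF; exists n.
- move=> A B [mA NA] [mB NB]; split; first exact: measurableI.
  by have := null_multiplierM NA NB; congr null_multiplier; rewrite indicI.
Qed.

(** The sets whose preimage lies in a sigma-algebra form a sigma-algebra, so generators suffice.
    This is used twice: for open rays on the line, and for preimages under the two coordinates in
    the plane. *)
Lemma measurable_null_multiplier (E : set (circle R)) : measurable E ->
  null_multiplier (\1_E : circle R -> R).
Proof.
suff : (measurable : set (set (circle R))) `<=` null_multiplier_set.
  by move=> + mE => /(_ _ mE)[].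
have SA := sigma_algebra_null_multiplier.
have coord (g : circle R -> R) : null_multiplier g ->
    forall B : set (measurableTypeR R), measurable B -> null_multiplier_set (g @^-1` B).
  move=> Ng B mB.
  have : (@RGenOInfty.G R).-sigma.-measurable B by rewrite -RGenOInfty.measurableE.
  rewrite -[g @^-1` B]setTI; move: B {mB}.
  apply: smallest_sub; first exact: (sigma_algebra_image g SA).
  move=> _ [a ->]; rewrite /image_set_system/= setTI.
  have := null_multiplier_set_gt a Ng; congr null_multiplier_set.
  by apply/seteqP; split => z /=; rewrite in_itv/= andbT.
move=> _ [B mB <-]; move: B mB.
apply: smallest_sub; first exact: (sigma_algebra_image (@circle_coord R) SA).
move=> C [|] [B mB <-]; rewrite /image_set_system/= !setTI.
- exact: coord null_multiplier_Re _ mB.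
- exact: coord null_multiplier_Im _ mB.
Qed.

(** The coefficient of index 0 of [f] times an indicator is the integral of [f] over the set. All
    these integrals vanish, hence so does each coordinate almost everywhere. *)
Lemma fourier_null_ae0 f : fourier_null f -> \forall z \ae mu, f z = 0.
Proof.
move=> f0; have [ir ii] := f0.1.
have H (P : R[i] -> R) : mu.-integrable [set: circle R] (EFin \o (P \o f)) ->
    (forall (z : R[i]) (b : bool), P (z * b%:R%:C%C) = P z * b%:R) ->
    (forall E, measurable E ->
      (\int[mu]_z P (f z * (\1_E z)%:C%C))%R = 0) ->
    \forall z \ae mu, P (f z) = 0.
  move=> iP PE P0.
  have : ae_eq mu [set: circle R] (EFin \o (P \o f)) (cst 0%E).
    apply: integral_ae_eq => // E _ mE.
    rewrite integral0 -[LHS]fineK; last first.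
      by apply: integrable_fin_num => //; exact: integrableS iP.
    congr EFin; rewrite -[RHS](P0 E mE).
    rewrite -[LHS]/(\int[mu]_(z in E) P (f z))%R Rintegral_mkcond.
    apply: eq_Rintegral => z _; rewrite patchE indicE PE.
    by case: (z \in E); rewrite ?mulr1 ?mulr0.
  by apply: filterS => z /(_ I)[].
have N E : measurable E -> cintegral mu (fun z => f z * (\1_E z)%:C%C) = 0.
  move=> mE; case: (measurable_null_multiplier mE) => _ _ /(_ f f0)[_ /(_ 0)].
  by under eq_fun do rewrite monomial0 mulr1.
have zr : \forall z \ae mu, Re (f z) = 0.
  apply: (H (@complex.Re R)) => // [z b|E mE]; last exact: (congr1 Re (N E mE)).
  by rewrite cReM_real.
have zi : \forall z \ae mu, Im (f z) = 0.
  apply: (H (@complex.Im R)) => // [z b|E mE]; last exact: (congr1 Im (N E mE)).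
  by rewrite cImM_real.
by apply: filterS2 zr zi => z rz iz; apply: complex_eqP; rewrite ?rz ?iz.
Qed.

End FourierUniqueness.

(** * The Hilbert space L2 of the circle *)

Lemma cvg_half_expr (R : realType) : (fun j => 2^-1 ^+ j) @ \oo --> (0 : R).
Proof. by apply: cvg_expr; rewrite ger0_norm// invf_lt1// ltr1n. Qed.

Lemma cvg_half_sqr (R : realType) (c : R) :
  (fun j => c * (2^-1 ^+ j) ^+ 2) @ \oo --> (0 : R).
Proof.
rewrite -(mulr0 c) -[X in _ * X](mulr0 (0 : R)).
by apply: cvgM; [exact: cvg_cst|apply: cvgM; exact: cvg_half_expr].
Qed.

Section L2Space.
Variable R : realType.
Local Notation mu := (@circle_measure R).
Implicit Types (u v w : L2 R) (c : R[i]).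

Lemma L2_funP u : (u : circle R -> R[i]) \in cLfun mu 2%:E.
Proof. exact: cLspace_funP. Qed.

Lemma L2_cmeasurable u : cmeasurable (u : circle R -> R[i]).
Proof. by have /cLfun2P[] := L2_funP u. Qed.

(** A class is evaluated at points through a chosen representative, so this and the pointwise rules
    below hold only almost everywhere. *)
Lemma cLclass_funE (p : \bar R) (p1 : (1 <= p)%E) (f : circle R -> R[i])
    (Lf : f \in cLfun mu p) : \forall z \ae mu, cLclass p1 Lf z = f z.
Proof.
have := cLclassK (Sub f Lf : cLfunType mu p1).
by apply: filterS => z /(_ I); rewrite SubK.
Qed.

Lemma L2_addE u v : \forall z \ae mu, (u + v : L2 R) z = u z + v z.
Proof.
have := cLclassK (repr u + repr v).
by apply: filterS => z /(_ I).
Qed.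

Lemma L2_scaleE c u : \forall z \ae mu, (c *: u : L2 R) z = c * u z.
Proof.
have := cLclassK (c *: repr u).
by apply: filterS => z /(_ I).
Qed.

Lemma L2_eq u v : (\forall z \ae mu, u z = v z) -> u = v.
Proof. by move=> uv; apply/cLspace_eqP; apply: filterS uv => z. Qed.

Lemma L2_0E : \forall z \ae mu, (0 : L2 R) z = 0.
Proof.
by have := L2_scaleE 0 0; rewrite scale0r; apply: filterS => z ->; rewrite mul0r.
Qed.

Lemma L2_subE u v : \forall z \ae mu, (u - v : L2 R) z = u z - v z.
Proof.
rewrite -scaleN1r; apply: filterS2 (L2_addE u (-1 *: v)) (L2_scaleE (-1) v) => z.
by move=> -> ->; rewrite mulN1r.
Qed.

(** The hypothesis is restricted to [r] because [symbol_Linfty] knows the action of [T] only on the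
    frequencies that occur in the sum. *)
Lemma L2_linear_sumE (I : eqType) (r : seq I) (c : I -> R[i]) (F : I -> L2 R)
    (f : I -> circle R -> R[i]) :
  {in r, forall i, \forall z \ae mu, F i z = f i z} ->
  \forall z \ae mu, (\sum_(i <- r) c i *: F i : L2 R) z = \sum_(i <- r) c i * f i z.
Proof.
elim: r => [|i r IHr] Ff.
  by rewrite big_nil; apply: filterS L2_0E => z ->; rewrite big_nil.
have {}IHr := IHr (fun j jr => Ff j (mem_behead (s := i :: r) jr)).
rewrite big_cons.
apply: filterS2 (filterI (L2_addE (c i *: F i) (\sum_(j <- r) c j *: F j)) IHr)
  (filterI (L2_scaleE (c i) (F i)) (Ff i (mem_head i r))) => z [-> ->] [-> ->].
by rewrite big_cons.
Qed.

Lemma zpowE n : \forall z \ae mu, zpow R n z = monomial n z.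
Proof. exact: cLclass_funE. Qed.

Lemma cmeasurable_conjM (f g : circle R -> R[i]) : cmeasurable f ->
  cmeasurable g -> cmeasurable (fun z => f z * (g z)^*).
Proof. by move=> mf mg; apply: cmeasurableM => //; exact: cmeasurable_conj. Qed.

Lemma ae_eq_cinner (f f' g g' : circle R -> R[i]) :
  cmeasurable f -> cmeasurable f' -> cmeasurable g -> cmeasurable g' ->
  (\forall z \ae mu, f z = f' z) -> (\forall z \ae mu, g z = g' z) ->
  cinner mu f g = cinner mu f' g'.
Proof.
move=> mf mf' mg mg' ff gg; apply: ae_eq_cintegral; try exact: cmeasurable_conjM.
by apply: filterS2 ff gg => z -> ->.
Qed.

Lemma cintegrable_inner u v : cintegrable mu (fun z => u z * (v z)^*).
Proof. by apply: cintegrable_mul; [|apply: cLfun2_conj]; exact: L2_funP. Qed.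

Lemma inner_conj u v : inner v u = (inner u v)^*.
Proof.
rewrite -[RHS](cintegral_conj (cintegrable_inner u v)); congr cintegral.
apply/funext => z; change ((v z * (u z)^*) = (u z * (v z)^*)^*).
by rewrite rmorphM /= conjCK mulrC.
Qed.

Lemma innerDl u v w : inner (u + v) w = inner u w + inner v w.
Proof.
rewrite -[RHS](cintegralD (cintegrable_inner u w) (cintegrable_inner v w)).
apply: ae_eq_cintegral.
- by apply: cmeasurable_conjM; exact: L2_cmeasurable.
- by apply: cmeasurableD; apply: cmeasurable_conjM; exact: L2_cmeasurable.
- by apply: filterS (L2_addE u v) => z ->; rewrite mulrDl.
Qed.

Lemma innerZl c u v : inner (c *: u) v = c * inner u v.
Proof.
rewrite -[RHS](cintegralZ c (cintegrable_inner u v)).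
apply: ae_eq_cintegral.
- by apply: cmeasurable_conjM; exact: L2_cmeasurable.
- apply: cmeasurableM; first exact: cmeasurable_cst.
  by apply: cmeasurable_conjM; exact: L2_cmeasurable.
- by apply: filterS (L2_scaleE c u) => z ->; rewrite mulrA.
Qed.

Lemma innerZr c u v : inner u (c *: v) = c^* * inner u v.
Proof. by rewrite inner_conj innerZl rmorphM/= -inner_conj. Qed.

Lemma innerBl u v w : inner (u - v) w = inner u w - inner v w.
Proof. by rewrite -scaleN1r innerDl innerZl mulN1r. Qed.

Lemma inner_suml (I : Type) (r : seq I) (F : I -> L2 R) v :
  inner (\sum_(i <- r) F i) v = \sum_(i <- r) inner (F i) v.
Proof.
elim: r => [|i r IHr]; last by rewrite !big_cons innerDl IHr.
by rewrite !big_nil -(scale0r 0) innerZl mul0r.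
Qed.

Lemma fourierE u n : fourier u n = inner u (zpow R n).
Proof.
apply: ae_eq_cinner; try exact: L2_cmeasurable; try exact: cmeasurable_monomial.
- exact: aeW.
- by apply: filterS (zpowE n) => z ->.
Qed.

Lemma inner_zpow m n : inner (zpow R m) (zpow R n) = (m == n)%:R.
Proof.
rewrite -subr_eq0 -(cintegral_monomial R); apply: ae_eq_cintegral.
- by apply: cmeasurable_conjM; exact: L2_cmeasurable.
- exact: cmeasurable_monomial.
- by apply: filterS2 (zpowE m) (zpowE n) => z -> ->; rewrite monomial_mul_conj.
Qed.

Definition sqnorm u : R := fine (sqint mu u).

Lemma sqintE u : sqint mu u = (sqnorm u)%:E.
Proof.
rewrite fineK// ge0_fin_numE ?sqint_ge0//.
by have /cLfun2P[] := L2_funP u.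
Qed.

Lemma sqnorm_ge0 u : 0 <= sqnorm u.
Proof. by rewrite fine_ge0// sqint_ge0. Qed.

Lemma inner_self u : inner u u = (sqnorm u)%:C%C.
Proof. exact/cinner_self/L2_funP. Qed.

Lemma sqnormB u v :
  (sqnorm (u - v))%:C%C = inner u u - inner u v - (inner u v)^* + inner v v.
Proof.
rewrite -inner_self innerBl [inner u _]inner_conj [inner v _]inner_conj !innerBl.
rewrite !rmorphB/= -!inner_conj.
by rewrite opprB addrA addrAC.
Qed.

(** The squared norm of [A u - c v], with [A = |v|^2] and [c = <u, v>], is nonnegative; this choice
    avoids dividing by [A]. *)
Lemma cauchy_schwarz u v : normc (inner u v) ^+ 2 <= sqnorm u * sqnorm v.
Proof.
set c := inner u v; set A := sqnorm v; set U := sqnorm u.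
have A0 : 0 <= A by exact: sqnorm_ge0.
have E : sqnorm (A%:C%C *: u - c *: v) = A * (A * U - normc c ^+ 2).
  apply: (@complexI R); rewrite sqnormB !innerZl !innerZr !inner_self -/A -/U -/c.
  rewrite !conjC_real [c^* * c]mulrC (mulrA c) mulr_conj !rmorphM/= !conjC_real.
  by apply: complex_eqP => /=; ring.
have := sqnorm_ge0 (A%:C%C *: u - c *: v); rewrite E.
(* For [A = 0] the expansion says nothing, but then [v] is 0 almost everywhere and [c = 0]. *)
have [A00 _|A0'] := eqVneq A 0; last first.
  by rewrite pmulr_rge0 ?lt_def ?A0' ?A0// subr_ge0 [A * U]mulrC.
have v0 : \forall z \ae mu, v z = 0.
  apply: sqint_eq0; first exact: L2_cmeasurable.
  by rewrite sqintE -/A A00.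
have -> : c = 0.
  rewrite -(cintegral0 mu); apply: ae_eq_cintegral.
  - by apply: cmeasurable_conjM; exact: L2_cmeasurable.
  - exact: cmeasurable_cst.
  - by apply: filterS v0 => z ->; rewrite rmorph0 mulr0.
by rewrite Normc.normc0 expr0n/= A00 mulr0.
Qed.

(** The difference is integrable, being a product of two L2 functions (itself and [z^0]), so
    [fourier_null_ae0] applies to it. *)
Lemma L2_ext u v : (forall n, fourier u n = fourier v n) -> u = v.
Proof.
move=> uv; apply/subr0_eq; apply: L2_eq.
have wE n : fourier (u - v : L2 R) n = 0 by rewrite fourierE innerBl -!fourierE uv subrr.
set w : L2 R := u - v in wE *.
have w0 : fourier_null w.
  split.
    have := cintegrable_mul (L2_funP w) (monomial_L2 R 0).
    by under eq_fun do rewrite monomial0 mulr1.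
  move=> n; rewrite -[RHS](wE (- n)); congr cintegral; apply/funext => z.
  by rewrite monomial_conj opprK.
by apply: filterS2 (fourier_null_ae0 w0) L2_0E => z -> ->.
Qed.

(** * Fourier sums and Bessel's inequality *)

Section OrthonormalSequence.
Variable sigma : nat -> int.
Hypothesis sigma_inj : injective sigma.
Implicit Types r : seq nat.

Lemma inner_sum_zpow r (c : nat -> R[i]) n :
  inner (\sum_(i <- r) c i *: zpow R (sigma i)) (zpow R n) =
  \sum_(i <- r) c i * (sigma i == n)%:R.
Proof.
by rewrite inner_suml; apply: eq_bigr => i _; rewrite innerZl inner_zpow.
Qed.

Lemma inner_sum_zpow_mem r (c : nat -> R[i]) k : uniq r ->
  inner (\sum_(i <- r) c i *: zpow R (sigma i)) (zpow R (sigma k)) =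
  if k \in r then c k else 0.
Proof.
move=> ur; rewrite inner_sum_zpow.
have H : \sum_(i <- r | i != k) c i * (sigma i == sigma k)%:R = 0.
  by apply: big1 => i ik; rewrite inj_eq// (negbTE ik) mulr0.
case: ifPn => kr.
  by rewrite (bigD1_seq k)//= H eqxx mulr1 addr0.
rewrite -[RHS]H -[RHS]big_filter; congr bigop.
by apply/esym/all_filterP/allP => i ir; apply: contraNneq kr => <-.
Qed.

Lemma sqnorm_sum r (c : nat -> R[i]) : uniq r ->
  sqnorm (\sum_(i <- r) c i *: zpow R (sigma i)) = \sum_(i <- r) normc (c i) ^+ 2.
Proof.
move=> ur; apply: (@complexI R); rewrite -inner_self inner_suml rmorph_sum/=.
apply: eq_big_seq => i ir; rewrite innerZl inner_conj inner_sum_zpow_mem// ir.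
exact: mulr_conj.
Qed.

(** The sequence [sigma] selects the frequencies: [Posz] for the nonnegative ones, [Negz] for the
    negative ones, [enum_int] for all. *)
Definition fourier_sum u r : L2 R :=
  \sum_(i <- r) fourier u (sigma i) *: zpow R (sigma i).

(** Pythagoras: the inner product of [u] with its Fourier sum equals the squared norm of that
    sum. *)
Lemma sqnorm_sub_fourier_sum u r : uniq r ->
  sqnorm (u - fourier_sum u r) =
  sqnorm u - \sum_(i <- r) normc (fourier u (sigma i)) ^+ 2.
Proof.
move=> ur; apply: (@complexI R); rewrite sqnormB.
have E : inner u (fourier_sum u r) =
    (\sum_(i <- r) normc (fourier u (sigma i)) ^+ 2)%:C%C.
  rewrite inner_conj inner_suml rmorph_sum/= rmorph_sum.
  apply: eq_bigr => i _; rewrite innerZl (inner_conj u) -fourierE.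
  by rewrite rmorphM/= conjCK mulrC; exact: mulr_conj.
rewrite E !inner_self sqnorm_sum// rmorphB/=.
by rewrite conjC_real subrK.
Qed.

Lemma bessel u r : uniq r ->
  \sum_(i <- r) normc (fourier u (sigma i)) ^+ 2 <= sqnorm u.
Proof.
by move=> ur; rewrite -subr_ge0 -sqnorm_sub_fourier_sum// sqnorm_ge0.
Qed.

End OrthonormalSequence.

Lemma normc_fourier_le u n : normc (fourier u n) ^+ 2 <= sqnorm u.
Proof.
(* Any injective sequence that starts at [n] will do: Bessel's inequality is used for its first term
   only. *)
have inj : injective (fun i : nat => n + i%:Z) by move=> i j /addrI[].
by have := @bessel _ inj u [:: 0%N] isT; rewrite big_seq1 addr0.
Qed.

(* [phi] selects a rapidly converging subsequence of the partial sums, so that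
   they also converge almost everywhere. *)
Lemma fourier_sum_cvg (sigma : nat -> int) u : injective sigma ->
  exists (phi : nat -> nat) (h : L2 R),
    [/\ (\forall z \ae mu,
           ccvg (fun j => fourier_sum sigma u (index_iota 0 (phi j)) z) (h z)),
        forall j, sqnorm (h - fourier_sum sigma u (index_iota 0 (phi j))) <=
                  (2^-1 ^+ j) ^+ 2,
        forall k, fourier h (sigma k) = fourier u (sigma k) &
        forall n, (forall k, sigma k != n) -> fourier h n = 0].
Proof.
move=> si; pose a i := normc (fourier u (sigma i)) ^+ 2.
pose s n := \sum_(0 <= i < n) a i.
have a0 i : 0 <= a i by exact: sqr_ge0.
have sD m n : (m <= n)%N -> s n = s m + \sum_(m <= i < n) a i.
  by move=> mn; rewrite /s (big_cat_nat (leq0n m) mn).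
have nds : nondecreasing_seq s.
  by move=> m n mn; rewrite (sD m n)// lerDl sumr_ge0.
have cs : cvgn s.
  apply: nondecreasing_is_cvgn => //; exists (sqnorm u) => _ [n _ <-].
  by apply: (bessel si); exact: iota_uniq.
(* The partial sums of [|fourier u|^2] converge by Bessel's inequality; [N j] is where their tail
   falls below [4^-j]. *)
have /choice[N HN] : forall j, exists N,
    forall k, (N <= k)%N -> s k - s N <= (2^-1 ^+ j) ^+ 2.
  move=> j; have e0 : 0 < (2^-1 ^+ j) ^+ 2 :> R by rewrite !exprn_gt0.
  have /cvgrPdist_le/(_ _ e0)[N _ HN] : s @ \oo --> limn s by [].
  exists N => k Nk; have := HN N (leqnn N); rewrite ger0_norm; last first.
    by rewrite subr_ge0; exact: nondecreasing_cvgn_le.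
  by apply: le_trans; rewrite lerD2r; exact: nondecreasing_cvgn_le.
(* The maximum makes [phi] monotone, with [phi j >= N j] for the speed of convergence and
   [phi j >= j] so that every term is eventually included. *)
pose phi j := (\max_(i < j.+1) maxn (N i) i)%N.
have phi_max j i : (i <= j)%N -> (maxn (N i) i <= phi j)%N.
  by move=> ij; exact: (leq_bigmax (Ordinal (ij : (i < j.+1)%N))).
have phi_nd j k : (j <= k)%N -> (phi j <= phi k)%N.
  move=> jk; apply/bigmax_leqP => i _; apply: phi_max.
  by rewrite (leq_trans _ jk)// -ltnS.
pose S n : L2 R := fourier_sum sigma u (index_iota 0 n).
have SB m n : (m <= n)%N -> sqnorm (S n - S m) = s n - s m.
  move=> mn; have -> : S n - S m =
      \sum_(i <- index_iota m n) fourier u (sigma i) *: zpow R (sigma i).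
    rewrite /S /fourier_sum (big_cat_nat (leq0n m) mn)/=.
    by rewrite addrAC subrr add0r.
  by rewrite sqnorm_sum ?iota_uniq// (sD m n mn) addrAC subrr add0r.
have mS n : cmeasurable (S n : circle R -> R[i]) by exact: L2_cmeasurable.
have sqB v w : sqint mu (fun z => v z - w z) = (sqnorm (v - w))%:E.
  rewrite -sqintE; apply: ae_eq_sqint.
  - by apply: cmeasurableB; exact: L2_cmeasurable.
  - exact: L2_cmeasurable.
  - by apply: filterS (L2_subE v w) => z ->.
have [f [mf Sf fS]] : exists f : circle R -> R[i], [/\ cmeasurable f,
    (\forall z \ae mu, ccvg (fun j => S (phi j) z) (f z)) &
    forall j, (sqint mu (fun z => f z - S (phi j) z)%R <= ((2^-1 ^+ j) ^+ 2)%:E)%E].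
  apply: riesz_fischer => // j k jk.
  rewrite sqB lee_fin SB ?phi_nd//.
  have Nj : (N j <= phi j)%N by rewrite (leq_trans _ (phi_max j j _))// leq_maxl.
  apply: le_trans (HN j (phi k) (leq_trans Nj (phi_nd _ _ jk))).
  by rewrite lerB// nds.
(* [f] is the sum of [f - S (phi 0)] and [S (phi 0)], both square integrable. *)
have Lf : f \in cLfun mu 2%:E.
  apply/cLfun2P; split => //.
  have /cLfun2P[_ g1] : (fun z => f z - S (phi 0%N) z) \in cLfun mu 2%:E.
    apply/cLfun2P; split; first exact: cmeasurableB.
    by rewrite (le_lt_trans (fS 0%N))// ltry.
  have Lg : (fun z => f z - S (phi 0%N) z) \in cLfun mu 2%:E.
    by apply/cLfun2P; split => //; exact: cmeasurableB.
  have := cLfunD (lee1n 2) Lg (L2_funP (S (phi 0%N))).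
  rewrite (_ : _ + _ = f); first by move=> /cLfun2P[].
  by apply/funext => z; rewrite fctE subrK.
pose h : L2 R := cLclass (lee1n 2) Lf.
have hE : \forall z \ae mu, h z = f z by exact: cLclass_funE.
have hS j : sqnorm (h - S (phi j)) <= (2^-1 ^+ j) ^+ 2.
  rewrite -lee_fin -sqB (le_trans _ (fS j))// le_eqVlt; apply/orP; left.
  apply/eqP; apply: ae_eq_sqint; [|exact: cmeasurableB|].
  - by apply: cmeasurableB => //; exact: L2_cmeasurable.
  - by apply: filterS hE => z ->.
(* Fourier coefficients are continuous in L2: they differ by at most the norm of [h - S (phi j)]. *)
have coef n l : (\forall j \near \oo, fourier (S (phi j)) n = l) -> fourier h n = l.
  move=> [N0 _ Hl]; apply/eqP; rewrite -subr_eq0; apply/eqP/Normc.eq0_normc/eqP.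
  have le j : (N0 <= j)%N -> normc (fourier h n - l) <= 2^-1 ^+ j.
    move=> Nj; rewrite -(@ler_pXn2r _ 2)// ?nnegrE ?normc_ge0 ?exprn_ge0//.
    apply: le_trans (hS j); rewrite -(Hl j Nj) !fourierE -innerBl -fourierE.
    exact: normc_fourier_le.
  rewrite eq_le normc_ge0 andbT.
  have c0 := @cvg_half_expr R.
  rewrite -(cvg_lim _ c0)//; apply: limr_ge; first exact: cvgP c0.
  by exists N0 => // j; exact: le.
exists phi, h; split => //.
- by apply: filterS2 Sf hE => z Sz ->.
(* The sum runs over [i < phi j], so the term [k] is present once [j > k]. *)
- move=> k; apply: coef; exists k.+1 => // j /= kj.
  rewrite fourierE inner_sum_zpow_mem ?iota_uniq//.
  by rewrite mem_index_iota/= (leq_trans kj)// (leq_trans _ (phi_max j j _))// leq_maxr.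
- move=> n nk; apply: coef; apply: nearW => j.
  rewrite fourierE inner_sum_zpow big1_seq// => i _.
  by rewrite (negbTE (nk i)) mulr0.
Qed.

End L2Space.

(** * The Riesz projection and operators with a symbol *)

Section RieszProjection.
Variable R : realType.
Local Notation mu := (@circle_measure R).
Implicit Types u v w : L2 R.

Lemma fourier_zpow m n : fourier (zpow R m) n = (m == n)%:R.
Proof. by rewrite fourierE inner_zpow. Qed.

(** [h] is the sum of the Fourier series of [u] over the nonnegative frequencies. Then [u - h] is
    orthogonal to [z^k] for [k >= 0], hence to the Fourier sums of any [g] in [H2], and by
    Cauchy-Schwarz to their limit [g]. *)
Lemma exists_projP u : exists h : L2 R,
  H2 h /\ orthocomplement (@H2 R) (u - h).
Proof.
have Pinj : injective Posz by move=> i j [].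
have [phi [h [_ _ hit miss]]] := fourier_sum_cvg u Pinj.
exists h; split => //; first by move=> n n0; apply: miss => k; case: n n0.
move=> g Hg; set w := u - h.
have w0 (k : nat) : inner w (zpow R k) = 0.
  by rewrite innerBl -!fourierE hit subrr.
have [psi [g' [_ gS hitg missg]]] := fourier_sum_cvg g Pinj.
have -> : g = g'.
  apply: L2_ext => -[k|k]; first by rewrite hitg.
  by rewrite missg// Hg.
pose S j := fourier_sum Posz g (index_iota 0 (psi j)).
have Sw j : inner (S j) w = 0.
  rewrite inner_suml big1// => i _.
  by rewrite innerZl inner_conj w0 rmorph0 mulr0.
rewrite inner_conj; apply/eqP; rewrite conjC_eq0; apply/eqP/Normc.eq0_normc/eqP.
rewrite -sqrf_eq0 eq_le sqr_ge0 andbT.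
have c0 := cvg_half_sqr (sqnorm w).
rewrite -(cvg_lim _ c0)//; apply: limr_ge; first exact: cvgP c0.
apply: nearW => j; rewrite -[inner g' w]subr0 -(Sw j) -innerBl.
apply: (le_trans (cauchy_schwarz _ _)).
by rewrite mulrC ler_wpM2l ?sqnorm_ge0//; exact: gS.
Qed.

Lemma fourier_projP u n :
  fourier (projP u) n = if 0 <= n then fourier u n else 0.
Proof.
have [h [Hh Oh]] := exists_projP u.
have [HP OP] : H2 (projP u) /\ orthocomplement (@H2 R) (u - projP u).
  (* By existence, [xget] returns an actual projection and not its default 0. *)
  by apply: (@xgetPex _ 0 [set g | H2 g /\ orthocomplement (@H2 R) (u - g)]); exists h.
case: n => [k|k] /=; last exact: HP.
apply/esym/subr0_eq; rewrite !fourierE -innerBl; apply: OP => n n0.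
by rewrite fourier_zpow; case: n n0.
Qed.

Lemma fourier_projQ u n :
  fourier (projQ u) n = if 0 <= n then 0 else fourier u n.
Proof.
rewrite fourierE /projQ innerBl -!fourierE fourier_projP.
by case: ifP; rewrite ?subrr ?subr0.
Qed.

Lemma projP_zpow n : projP (zpow R n) = if 0 <= n then zpow R n else 0.
Proof.
apply: L2_ext => m; rewrite fourier_projP fourier_zpow.
have F0 : fourier (0 : L2 R) m = 0.
  by rewrite fourierE -(scale0r 0) innerZl mul0r.
have [m0|m0] := boolP (0 <= m); case: (boolP (0 <= n)) => n0;
  rewrite ?F0 ?fourier_zpow//; case: eqVneq => // nm.
  by move: n0; rewrite nm m0.
by move: m0; rewrite -nm n0.
Qed.

Lemma projQ_zpow n : projQ (zpow R n) = if 0 <= n then 0 else zpow R n.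
Proof. by rewrite /projQ projP_zpow; case: ifP; rewrite ?subrr ?subr0. Qed.

Lemma cLspace_mulE (a : Linfty R) u :
  \forall z \ae mu, (cLspace_mul a u : L2 R) z = a z * u z.
Proof. exact: cLclass_funE. Qed.

Lemma opSE (a b : Linfty R) u :
  \forall z \ae mu, opS a b u z = a z * projP u z + b z * projQ u z.
Proof.
apply: filterS2 (L2_addE (cLspace_mul a (projP u)) (cLspace_mul b (projQ u)))
  (filterI (cLspace_mulE a (projP u)) (cLspace_mulE b (projQ u))) => z.
by move=> -> [-> ->].
Qed.

Lemma Linfty_cmeasurable (a : Linfty R) : cmeasurable (a : circle R -> R[i]).
Proof. by have /cLfunP[] := cLspace_funP a. Qed.

Lemma inner_opS (a b : Linfty R) m n : inner (opS a b (zpow R n)) (zpow R m) =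
  if 0 <= n then fourier a (m - n) else fourier b (m - n).
Proof.
have E (c : Linfty R) : (\forall z \ae mu, opS a b (zpow R n) z = c z * monomial n z) ->
    inner (opS a b (zpow R n)) (zpow R m) = fourier c (m - n).
  move=> H; apply: ae_eq_cintegral.
  - by apply: cmeasurable_conjM; exact: L2_cmeasurable.
  - by apply: cmeasurable_conjM; [exact: Linfty_cmeasurable|exact: cmeasurable_monomial].
  - apply: filterS2 H (zpowE R m) => z -> ->.
    by rewrite -mulrA monomial_mul_conj monomial_conj opprB.
have H := opSE a b (zpow R n); move: H; rewrite projP_zpow projQ_zpow.
case: ifP => _ H; apply: E.
  apply: filterS2 H (filterI (L2_0E R) (zpowE R n)) => z -> [-> ->].
  by rewrite mulr0 addr0.
apply: filterS2 H (filterI (L2_0E R) (zpowE R n)) => z -> [-> ->].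
by rewrite mulr0 add0r.
Qed.

Definition mul_monomial n u : L2 R :=
  cLspace_mul (cLclass (ltW (ltry 1)) (monomial_Linfty R n) : Linfty R) u.

Lemma mul_monomialE n u : \forall z \ae mu, mul_monomial n u z = monomial n z * u z.
Proof.
apply: filterS2 (cLspace_mulE (cLclass (ltW (ltry 1)) (monomial_Linfty R n)) u)
  (cLclass_funE (ltW (ltry 1)) (monomial_Linfty R n)) => z.
by move=> -> ->.
Qed.

Lemma fourier_mul_monomial n u m : fourier (mul_monomial n u) m = fourier u (m - n).
Proof.
apply: ae_eq_cintegral.
- by apply: cmeasurable_conjM; [exact: L2_cmeasurable|exact: cmeasurable_monomial].
- by apply: cmeasurable_conjM; [exact: L2_cmeasurable|exact: cmeasurable_monomial].
- apply: filterS (mul_monomialE n u) => z ->.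
  by rewrite !monomial_conj opprB monomialD; ring.
Qed.

End RieszProjection.

(** * Operators that multiply monomials by a fixed function *)

Section Symbol.
Variable R : realType.
Local Notation mu := (@circle_measure R).
Variables (T : {linear L2 R -> L2 R}) (M : R).
Hypothesis TM : forall u : L2 R, sqnorm (T u) <= M ^+ 2 * sqnorm u.

(* The partial sums [S_j] of [u] give [T S_j = g S_j], and along a subsequence
   [T S_j] tends to [T u] in L2 while [g S_j] tends to [g u] a.e. *)
Lemma ae_symbol (sigma : nat -> int) (g : circle R -> R[i]) (u : L2 R) :
  injective sigma -> cmeasurable g ->
  (forall i, \forall z \ae mu, (T (zpow R (sigma i)) : L2 R) z = g z * monomial (sigma i) z) ->
  (forall n, (forall k, sigma k != n) -> fourier u n = 0) ->
  \forall z \ae mu, (T u : L2 R) z = g z * u z.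
Proof.
move=> si mg Tg u0.
have [phi [h [Sh hS hit miss]]] := fourier_sum_cvg u si.
have hu : h = u.
  apply: L2_ext => n; have [[k <-]|nk] := pselect (exists k, sigma k = n).
    exact: hit.
  have {}nk k : sigma k != n by apply/eqP => E; apply: nk; exists k.
  by rewrite miss// u0.
rewrite hu in Sh hS; pose S j := fourier_sum sigma u (index_iota 0 (phi j)).
have TS j : \forall z \ae mu, (T (S j) : L2 R) z = g z * S j z.
  rewrite /S /fourier_sum linear_sum /=.
  have E1 := @L2_linear_sumE R _ (index_iota 0 (phi j))
    (fun i => fourier u (sigma i)) (fun i => T (zpow R (sigma i)) : L2 R)
    (fun i z => g z * monomial (sigma i) z) (fun i _ => Tg i).
  have E2 := @L2_linear_sumE R _ (index_iota 0 (phi j))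
    (fun i => fourier u (sigma i)) (fun i => zpow R (sigma i))
    (fun i z => monomial (sigma i) z) (fun i _ => zpowE R (sigma i)).
  under eq_bigr do rewrite linearZ/=.
  apply: filterS2 E1 E2 => z -> ->.
  by rewrite mulr_sumr; apply: eq_bigr => i _; rewrite mulrCA.
have mgu (v : L2 R) : cmeasurable (fun z => (T u : L2 R) z - g z * v z).
  apply: cmeasurableB; first exact: L2_cmeasurable.
  by apply: cmeasurableM => //; exact: L2_cmeasurable.
(* Here [T u - g S_j = T (u - S_j)] almost everywhere, which is small because [T] is bounded. *)
have sqS j : (sqint mu (fun z => (T u : L2 R) z - g z * S j z)%R <=
    (M ^+ 2 * (2^-1 ^+ j) ^+ 2)%:E)%E.
  rewrite (@ae_eq_sqint _ _ _ _ _ (T (u - S j) : L2 R)).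
  - rewrite sqintE lee_fin (le_trans (TM _))// ler_wpM2l ?sqr_ge0//.
    exact: hS.
  - exact: mgu.
  - exact: L2_cmeasurable.
  - by rewrite linearB; apply: filterS2 (L2_subE (T u) (T (S j))) (TS j) => z -> ->.
suff : \forall z \ae mu, (T u : L2 R) z - g z * u z = 0.
  by apply: filterS => z /subr0_eq.
apply: sqint_eq0; first exact: mgu.
have c0 := cvg_half_sqr (M ^+ 2).
have c0E : (fun j => (M ^+ 2 * (2^-1 ^+ j) ^+ 2)%:E) @ \oo --> 0%E.
  by apply: cvg_EFin c0; exact: nearW.
rewrite -(cvg_lim _ c0E)//; apply: lime_ge; first exact: cvgP c0E.
apply: nearW => k.
apply: (@sqint_le_lim _ _ _ _ (fun j z => (T u : L2 R) z - g z * S j z)).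
- by move=> j; exact: mgu.
- exact: mgu.
- by apply: filterS Sh => z Sz; apply: ccvgBl; exact: ccvgMl.
- exists k => // j /= kj; rewrite (le_trans (sqS j))// lee_fin.
  rewrite ler_wpM2l ?sqr_ge0// ler_pXn2r ?nnegrE ?exprn_ge0//.
  by rewrite ler_wiXn2l// invf_le1// ler1n.
Qed.

(** The enumeration 0, -1, 1, -2, 2, ... of the integers. *)
Definition enum_int (i : nat) : int := if odd i then Negz i./2 else Posz i./2.

Lemma enum_int_inj : injective enum_int.
Proof.
move=> i j; rewrite /enum_int => ij.
rewrite -(odd_double_half i) -(odd_double_half j).
by move: ij; case: (odd i); case: (odd j) => // -[->].
Qed.

Lemma enum_int_surj n : exists k, enum_int k = n.
Proof.
case: n => k; first by exists k.*2; rewrite /enum_int odd_double doubleK.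
by exists k.*2.+1; rewrite /enum_int/= odd_double/= uphalf_double.
Qed.

Lemma indic_cLfun2 (E : set (circle R)) : measurable E ->
  (fun z => (\1_E z)%:C%C) \in cLfun mu 2%:E.
Proof.
move=> mE; apply: (@ae_le_cLnorm _ _ _ _ _ (lee1n 2) _ (cst 1)).
- by apply: cmeasurable_real; exact: measurable_indic.
- exact: Lfun_cst.
- apply: aeW => z; rewrite normc_real normr1 indicE.
  by case: (_ \in _); rewrite ?normr1 ?normr0.
Qed.

Lemma integral_scaled_indic (E : set (circle R)) (c : R) : measurable E ->
  (\int[mu]_z (c * \1_E z)%:E)%E = (c%:E * mu E)%E.
Proof.
move=> mE; under eq_integral do rewrite EFinM.
rewrite integralZl//; last exact: integrable_indic.
by rewrite integral_indic// setIT.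
Qed.

(* Multiplying by a power of z leaves the norm of a trigonometric polynomial
   unchanged and moves its frequencies to where [T] is multiplication by [g].
   Approximating the indicator function of E then bounds the integral of |g|^2
   over E by [M ^+ 2 * mu E]. *)
Lemma symbol_Linfty (g : circle R -> R[i]) : cmeasurable g ->
  (forall N : nat, exists K : int, forall n : int, (`|n| <= N)%N ->
     \forall z \ae mu, (T (zpow R (n + K)) : L2 R) z = g z * monomial (n + K) z) ->
  g \in cLfun mu +oo%E.
Proof.
move=> mg Tg.
have key E : measurable E ->
    (sqint mu (fun z => g z * (\1_E z)%:C%C)%R <= (M ^+ 2)%:E * mu E)%E.
  move=> mE; pose u : L2 R := cLclass (lee1n 2) (indic_cLfun2 mE).
  have uE : \forall z \ae mu, u z = (\1_E z)%:C%C by exact: cLclass_funE.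
  have m1 : cmeasurable (fun z => (\1_E z)%:C%C : R[i]).
    by apply: cmeasurable_real; exact: measurable_indic.
  have squ : (sqnorm u)%:E = mu E.
    rewrite -sqintE -[RHS]mul1e -(integral_scaled_indic 1 mE).
    rewrite (ae_eq_sqint (L2_cmeasurable u) m1 uE).
    apply: eq_integral => z _; rewrite normc_real mul1r indicE.
    by case: (z \in E); rewrite ?normr1 ?expr1n// normr0 expr0n.
  have [phi [h [Sh hS hit _]]] := fourier_sum_cvg u enum_int_inj.
  have hu : h = u by apply: L2_ext => n; have [k <-] := enum_int_surj n; exact: hit.
  rewrite hu in Sh hS; pose r j := index_iota 0 (phi j).
  have ur j : uniq (r j) by exact: iota_uniq.
  pose S j := fourier_sum enum_int u (r j).
  apply: (@sqint_le_lim _ _ _ _ (fun j z => g z * S j z)).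
  - by move=> j; apply: cmeasurableM => //; exact: L2_cmeasurable.
  - exact: cmeasurableM.
  - by apply: filterS2 Sh uE => z Sz <-; exact: ccvgMl.
  apply: nearW => j; rewrite -squ -EFinM.
  have [K HK] := Tg (\max_(i <- r j) absz (enum_int i))%N.
  (* [q] is [z^K S_j]: it has the coefficients of [S_j] at shifted frequencies, so Bessel's
     inequality for [u] bounds its norm. *)
  pose q : L2 R := \sum_(i <- r j) fourier u (enum_int i) *: zpow R (enum_int i + K).
  have Kinj : injective (fun i => enum_int i + K).
    by move=> a b /addIr; exact: enum_int_inj.
  have sq : sqnorm q <= sqnorm u.
    by rewrite (sqnorm_sum Kinj)//; exact: (bessel enum_int_inj).
  have Tq : \forall z \ae mu, (T q : L2 R) z = monomial K z * (g z * S j z).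
    have le i : i \in r j ->
        (absz (enum_int i) <= \max_(k <- r j) absz (enum_int k))%N.
      by move=> ir; exact: leq_bigmax_seq.
    have E1 := @L2_linear_sumE R _ (r j)
      (fun i => fourier u (enum_int i)) (fun i => T (zpow R (enum_int i + K)) : L2 R)
      (fun i z => g z * monomial (enum_int i + K) z)
      (fun i ir => HK (enum_int i) (le i ir)).
    have E2 := @L2_linear_sumE R _ (r j)
      (fun i => fourier u (enum_int i)) (fun i => zpow R (enum_int i))
      (fun i z => monomial (enum_int i) z) (fun i _ => zpowE R (enum_int i)).
    rewrite /q linear_sum/=; under eq_bigr do rewrite linearZ/=.
    apply: filterS2 E1 E2 => z -> ->.
    rewrite !mulr_sumr; apply: eq_bigr => i _.
    by rewrite monomialD; ring.
  (* The factor [z^K] has modulus 1, so [g S_j] and [T q] have the same modulus almost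
     everywhere. *)
  have -> : sqint mu (fun z => g z * S j z) = sqint mu (T q : L2 R).
    transitivity (sqint mu (fun z => monomial K z * (g z * S j z))).
      by apply: eq_integral => z _; rewrite [in RHS]Normc.normcM normc_monomial mul1r.
    apply: ae_eq_sqint; last by apply: filterS Tq => z ->.
    + apply: cmeasurableM; first exact: cmeasurable_monomial.
      by apply: cmeasurableM => //; exact: L2_cmeasurable.
    + exact: L2_cmeasurable.
  by rewrite sqintE lee_fin (le_trans (TM _))// ler_wpM2l// sqr_ge0.
(* Any constant above [|M|] works: on the set where [|g| > C], [key] gives [C^2 mu(E) <= M^2 mu(E)],
   which forces [mu(E) = 0]. *)
pose C := `|M| + 1.
pose E := [set z | C < normc (g z)].
have mE : measurable E.
  have mn := measurable_normc mg.
  rewrite (_ : E = setT `&` (fun z => normc (g z)) @^-1` `]C, +oo[%classic).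
    exact: mn.
  by rewrite setTI; apply/seteqP; split => z /=; rewrite in_itv/= andbT.
have C0 : 0 <= C by rewrite addr_ge0.
have E0 : mu E = 0%E.
  have : ((C ^+ 2)%:E * mu E <= (M ^+ 2)%:E * mu E)%E.
    apply: le_trans (key E mE); rewrite -integral_scaled_indic//.
    apply: ge0_le_integral => //.
    - by move=> z _; rewrite lee_fin mulr_ge0// sqr_ge0.
    - by apply/measurable_EFinP; apply: measurable_funM => //; exact: measurable_indic.
    - apply: measurable_normc_sqr; apply: cmeasurableM => //.
      by apply: cmeasurable_real; exact: measurable_indic.
    - move=> z _; rewrite lee_fin Normc.normcM normc_real indicE.
      have [zE|zE] := boolP (z \in E); last by rewrite mulr0 sqr_ge0.
      rewrite normr1 !mulr1 ler_pXn2r ?nnegrE ?normc_ge0//.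
      by apply: ltW; exact: set_mem zE.
  have /fineK <- : mu E \is a fin_num by exact: fin_num_measure.
  rewrite -!EFinM lee_fin => H; congr EFin; apply/eqP; rewrite eq_le fine_ge0// andbT.
  have f0 : 0 <= fine (mu E) by rewrite fine_ge0.
  have M2 : M ^+ 2 = `|M| ^+ 2 by rewrite real_normK ?num_real.
  have := normr_ge0 M; move: H; rewrite M2 /C; nra.
have gC : \forall z \ae mu, normc (g z) <= C.
  exists E; split => // z /= /negP; rewrite -ltNge.
  by [].
apply/cLfunP; split => //.
rewrite /cLnorm unlock; case: ifPn => // _.
apply: (@le_lt_trans _ _ C%:E); last by rewrite ltry.
apply/ess_supP; apply: filterS gC => z gz /=.
by rewrite lee_fin ger0_norm ?normc_ge0.
Qed.

End Symbol.

(** * The characterization by matrix entries *)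

Local Open Scope complex_scope.

Theorem theorem2p1 (R : realType) (T : {linear L2 R -> L2 R})
    (T_bounded : bounded_operator T) :
  ((exists alpha beta : Linfty R, forall f : L2 R, T f = opS alpha beta f) <->
   (exists a b : int -> R[i], forall m n : int,
      inner (T (zpow R n)) (zpow R m) =
        if 0 <= n then a (m - n) else b (m - n)))
  /\
  (forall (alpha beta : Linfty R) (a b : int -> R[i]),
     (forall f : L2 R, T f = opS alpha beta f) ->
     (forall m n : int,
        inner (T (zpow R n)) (zpow R m) =
          if 0 <= n then a (m - n) else b (m - n)) ->
     forall n : int, a n = fourier alpha n /\ b n = fourier beta n).
Proof.
split; [split|].
- move=> [alpha [beta TS]]; exists (fourier alpha), (fourier beta) => m n.
  by rewrite TS inner_opS.
- move=> [a [b Tab]].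
  have [M TM] : exists M : R, forall u, sqnorm (T u) <= M ^+ 2 * sqnorm u.
    have [M HM] := T_bounded; exists M => u.
    by rewrite -lee_fin EFinM -!sqintE; exact: sqint_cLnorm_le (HM u).
  (* Both sides have [m]-th coefficient [a (m - n)]. *)
  have Tpos n : 0 <= n -> T (zpow R n) = mul_monomial n (T (zpow R 0)).
    move=> n0; apply: L2_ext => m; rewrite fourier_mul_monomial !fourierE !Tab n0.
    by rewrite lexx subr0.
  (* The column [-1] replaces the column 0, which is not governed by [b]; the extra factor [z]
     undoes its shift, and both sides have coefficients [b (m - n)]. *)
  have Tneg n : ~~ (0 <= n) ->
      T (zpow R n) = mul_monomial n (mul_monomial 1 (T (zpow R (-1)))).
    move=> n0; apply: L2_ext => m; rewrite !fourier_mul_monomial !fourierE !Tab (negbTE n0).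
    by congr b; ring.
  pose g1 : L2 R := T (zpow R 0); pose g2 : L2 R := mul_monomial 1 (T (zpow R (-1))).
  have m1 : cmeasurable (g1 : circle R -> R[i]) by exact: L2_cmeasurable.
  have m2 : cmeasurable (g2 : circle R -> R[i]) by exact: L2_cmeasurable.
  have T1 n : 0 <= n -> \forall z \ae @circle_measure R,
      (T (zpow R n) : L2 R) z = g1 z * monomial n z.
    by move=> n0; rewrite Tpos//; apply: filterS (mul_monomialE n g1) => z ->; rewrite mulrC.
  have T2 n : ~~ (0 <= n) -> \forall z \ae @circle_measure R,
      (T (zpow R n) : L2 R) z = g2 z * monomial n z.
    by move=> n0; rewrite Tneg//; apply: filterS (mul_monomialE n g2) => z ->; rewrite mulrC.
  have L1 : (g1 : circle R -> R[i]) \in cLfun (@circle_measure R) +oo%E.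
    (* Shifting by [N] makes all frequencies of modulus at most [N] nonnegative. *)
    apply: (symbol_Linfty TM) => // N; exists N => n nN; apply: T1.
    by lia.
  have L2' : (g2 : circle R -> R[i]) \in cLfun (@circle_measure R) +oo%E.
    (* The additional -1 makes the shifted frequencies strictly negative, also for [n = N]. *)
    apply: (symbol_Linfty TM) => // N; exists (- N%:Z - 1) => n nN; apply: T2.
    by lia.
  pose alpha : Linfty R := cLclass (ltW (ltry 1)) L1.
  pose beta : Linfty R := cLclass (ltW (ltry 1)) L2'.
  exists alpha, beta => f; apply: L2_eq.
  (* The two projections of [f] are handled separately, since each has only frequencies on which [T]
     multiplies by one and the same function. *)
  have EP : \forall z \ae @circle_measure R, (T (projP f) : L2 R) z = g1 z * projP f z.
    apply: (@ae_symbol _ _ _ TM Posz) => //.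
    + by move=> i j [].
    + by move=> i; exact: T1.
    + by move=> [k|k] nk; [have := nk k; rewrite eqxx|rewrite fourier_projP].
  have EQ : \forall z \ae @circle_measure R, (T (projQ f) : L2 R) z = g2 z * projQ f z.
    apply: (@ae_symbol _ _ _ TM Negz) => //.
    + by move=> i j [].
    + by move=> i; exact: T2.
    + by move=> [k|k] nk; [rewrite fourier_projQ|have := nk k; rewrite eqxx].
  have -> : T f = T (projP f) + T (projQ f) by rewrite -linearD /projQ addrC subrK.
  apply: filterS2 (filterI (opSE alpha beta f) (L2_addE (T (projP f)) (T (projQ f))))
    (filterI (filterI EP EQ) (filterI (cLclass_funE (ltW (ltry 1)) L1)
      (cLclass_funE (ltW (ltry 1)) L2'))) => z.
  by move=> [-> ->] [[-> ->] [-> ->]].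
- move=> alpha beta a b TS Tab n; split.
  (* The columns 0 and -1 of the matrix already contain all the [a n] and all the [b n]. *)
  + by have := Tab n 0; rewrite TS inner_opS lexx subr0.
  + by have := Tab (n - 1) (-1); rewrite TS inner_opS/= opprK subrK.
Qed.
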